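(* Let $\mathbf{A}_{01},\dots,\mathbf{A}_{24}$ and $\mathbb{C}^5$ be the $25$ complex $5$-dimensional nilpotent associative commutative algebras listed in the context (these represent all isomorphism classes of such algebras). Let $G$ be the directed graph whose vertices are these $25$ algebras and whose edges are exactly the following: $\mathbf{A}_{01}\to \mathbf{A}_{02},\mathbf{A}_{03}$; $\mathbf{A}_{02}\to \mathbf{A}_{04},\mathbf{A}_{05},\mathbf{A}_{06},\mathbf{A}_{07}$; $\mathbf{A}_{03}\to \mathbf{A}_{04},\mathbf{A}_{06}$; $\mathbf{A}_{04}\to \mathbf{A}_{08},\mathbf{A}_{09},\mathbf{A}_{13}$; $\mathbf{A}_{05}\to \mathbf{A}_{08}$; $\mathbf{A}_{06}\to \mathbf{A}_{08},\mathbf{A}_{09}$; $\mathbf{A}_{07}\to \mathbf{A}_{09}$; $\mathbf{A}_{08}\to \mathbf{A}_{10},\mathbf{A}_{11},\mathbf{A}_{14},\mathbf{A}_{16}$; $\mathbf{A}_{09}\to \mathbf{A}_{11},\mathbf{A}_{15}$; $\mathbf{A}_{10}\to \mathbf{A}_{12},\mathbf{A}_{18}$; $\mathbf{A}_{11}\to \mathbf{A}_{12},\mathbf{A}_{17},\mathbf{A}_{22}$; $\mathbf{A}_{12}\to \mathbf{A}_{20}$; $\mathbf{A}_{13}\to \mathbf{A}_{14},\mathbf{A}_{15},\mathbf{A}_{21}$; $\mathbf{A}_{14}\to \mathbf{A}_{17},\mathbf{A}_{18}$; $\mathbf{A}_{15}\to \mathbf{A}_{17},\mathbf{A}_{22}$;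 $\mathbf{A}_{16}\to \mathbf{A}_{19}$; $\mathbf{A}_{17}\to \mathbf{A}_{19},\mathbf{A}_{22}$; $\mathbf{A}_{18}\to \mathbf{A}_{20}$; $\mathbf{A}_{19}\to \mathbf{A}_{20}$; $\mathbf{A}_{20}\to \mathbf{A}_{23}$; $\mathbf{A}_{21}\to \mathbf{A}_{22}$; $\mathbf{A}_{22}\to \mathbf{A}_{23}$; $\mathbf{A}_{23}\to \mathbf{A}_{24}$; $\mathbf{A}_{24}\to \mathbb{C}^5$. Then $G$ describes all degenerations in the variety of complex $5$-dimensional nilpotent associative commutative algebras: for any two vertices $\mathbf{A},\mathbf{B}$ of $G$, the algebra $\mathbf{A}$ degenerates to $\mathbf{B}$ if and only if there is a directed path (possibly of length $0$) from $\mathbf{A}$ to $\mathbf{B}$ in $G$.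
   Context: All algebras are over $\mathbb{C}$. Let $\mathbf{V}$ be an $n$-dimensional complex vector space with a fixed basis $e_1,\dots,e_n$ (here $n=5$). A multiplication $\mu\in \mathrm{Hom}(\mathbf{V}\otimes\mathbf{V},\mathbf{V})$ is determined by its $n^3$ structure constants $c_{i,j}^k$, where $\mu(e_i\otimes e_j)=\sum_k c_{i,j}^k e_k$; this identifies $\mathrm{Hom}(\mathbf{V}\otimes\mathbf{V},\mathbf{V})$ with the affine variety $\mathbb{C}^{n^3}$ with its Zariski topology. The group $\mathrm{GL}(\mathbf{V})$ acts by $(g*\mu)(x\otimes y)=g\mu(g^{-1}x\otimes g^{-1}y)$; $O(\mu)$ denotes the orbit of $\mu$ and $\overline{O(\mu)}$ its Zariski closure. Orbits correspond to isomorphism classes of algebras. If $n$-dimensional algebras $\mathbf{A},\mathbf{B}$ are represented by $\mu,\lambda$ respectively, then $\mathbf{A}$ degenerates to $\mathbf{B}$ if $\lambda\in\overline{O(\mu)}$ (this does not depend on the choice of $\mu,\lambda$). The algebras. Each has basis $e_1,\dots,e_5$ and is commutative ($e_ie_j=e_je_i$); products of basis elements not listed, and not obtained from listed ones by commutativity, are zero. $\mathbb{C}^5$ denotes the $5$-dimensional algebra with zero multiplication. $\mathbf{A}_{01}$: $e_1^2=e_2,\ e_2^2=e_4,\ e_1e_3=e_4,\ e_1e_2=e_3,\ e_1e_4=e_5,\ e_2e_3=e_5$. $\mathbf{A}_{02}$: $e_1^2=e_3,\ e_2^2=e_5,\ e_3^2=e_5,\ e_1e_3=e_4,\ e_1e_4=e_5$.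 $\mathbf{A}_{03}$: $e_1^2=e_3,\ e_2^2=e_4,\ e_1e_3=e_5,\ e_2e_4=e_5$. $\mathbf{A}_{04}$: $e_1^2=e_3,\ e_1e_2=e_4,\ e_1e_4=e_5,\ e_2e_3=e_5$. $\mathbf{A}_{05}$: $e_1^2=e_2,\ e_2^2=e_4,\ e_1e_2=e_3,\ e_1e_3=e_4$. $\mathbf{A}_{06}$: $e_1^2=e_2,\ e_1e_2=e_3,\ e_4^2=e_5$. $\mathbf{A}_{07}$: $e_1e_3=e_4,\ e_2e_3=e_5,\ e_1e_2=e_4+e_5$. $\mathbf{A}_{08}$: $e_1^2=e_3,\ e_2^2=e_4,\ e_1e_3=e_4,\ e_1e_2=e_5$. $\mathbf{A}_{09}$: $e_1e_3=e_5,\ e_1e_2=e_4,\ e_2e_3=-e_5$. $\mathbf{A}_{10}$: $e_1^2=e_3,\ e_1e_3=e_4,\ e_1e_2=e_5$. $\mathbf{A}_{11}$: $e_1^2=e_4,\ e_2e_3=e_4,\ e_1e_3=e_5$. $\mathbf{A}_{12}$: $e_1e_2=e_4,\ e_1e_3=e_5$. $\mathbf{A}_{13}$: $e_3^2=e_4,\ e_1e_2=e_5,\ e_3e_4=e_5$. $\mathbf{A}_{14}$: $e_1^2=e_3,\ e_2^2=e_4,\ e_1e_3=e_4$. $\mathbf{A}_{15}$: $e_1e_2=e_3,\ e_4^2=e_5$. $\mathbf{A}_{16}$: $e_1^2=e_3,\ e_2^2=e_5,\ e_1e_2=e_4$. $\mathbf{A}_{17}$: $e_1^2=e_4,\ e_3^2=e_5,\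 e_1e_2=e_5$. $\mathbf{A}_{18}$: $e_1^2=e_2,\ e_1e_2=e_3$. $\mathbf{A}_{19}$: $e_1^2=e_3,\ e_2^2=e_4$. $\mathbf{A}_{20}$: $e_1^2=e_3,\ e_1e_2=e_4$. $\mathbf{A}_{21}$: $e_2e_3=e_5,\ e_1e_4=e_5$. $\mathbf{A}_{22}$: $e_1^2=e_4,\ e_2e_3=e_4$. $\mathbf{A}_{23}$: $e_1e_2=e_3$. $\mathbf{A}_{24}$: $e_1^2=e_2$. Known classification (due to Mazzola, taken as given and not part of the claim to be proved): every complex $5$-dimensional nilpotent associative commutative algebra is isomorphic to exactly one of $\mathbf{A}_{01},\dots,\mathbf{A}_{24},\mathbb{C}^5$. *)

(* Defs.v *)
From HB Require Import structures.
From mathcomp Require Import all_boot all_order all_algebra.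
From mathcomp Require Import classical_sets mpoly.

Set Implicit Arguments.
Unset Strict Implicit.
Unset Printing Implicit Defensive.

Import GRing.Theory.

Local Open Scope classical_set_scope.
Local Open Scope ring_scope.

Section Degeneration.
Variables (F : fieldType) (n : nat).

(* Hom(V (x) V, V) for V = F^n (column vectors), as the affine space F^(n^3) of
   structure constants: mu (i, j, k) is the e_k-coordinate of e_i e_j. *)
Definition mult := {ffun 'I_n * 'I_n * 'I_n -> F}.

Definition mulv (mu : mult) (x y : 'cV[F]_n) : 'cV[F]_n :=
  \col_k \sum_i \sum_j x i 0 * y j 0 * mu (i, j, k).

Definition mult_of (f : 'cV[F]_n -> 'cV[F]_n -> 'cV[F]_n) : mult :=
  [ffun t => f (delta_mx t.1.1 0) (delta_mx t.1.2 0) t.2 0].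

Definition gl_act (g : 'M[F]_n) (mu : mult) : mult :=
  mult_of (fun x y => g *m mulv mu (invmx g *m x) (invmx g *m y)).

Definition gl_orbit (mu : mult) : set mult :=
  [set nu | exists2 g : 'M[F]_n, g \in unitmx & nu = gl_act g mu].

Definition eval_mult (p : {mpoly F[#|{: 'I_n * 'I_n * 'I_n}|]}) (mu : mult) :
    F :=
  p.@[fun a => mu (enum_val a)].

Definition zariski_closed (Z : set mult) : Prop :=
  exists S : set {mpoly F[#|{: 'I_n * 'I_n * 'I_n}|]},
    Z = [set mu | forall p, S p -> eval_mult p mu = 0].

Definition zariski_closure (A : set mult) : set mult :=
  smallest zariski_closed A.

Definition degenerates_to (mu lambda : mult) : Prop :=
  zariski_closure (gl_orbit mu) lambda.

End Degeneration.

(* C5 is the algebra with zero multiplication. *)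
Inductive vertex : Set :=
  | A01 | A02 | A03 | A04 | A05 | A06 | A07 | A08
  | A09 | A10 | A11 | A12 | A13 | A14 | A15 | A16
  | A17 | A18 | A19 | A20 | A21 | A22 | A23 | A24
  | C5.

Definition vertices : seq vertex :=
  [:: A01; A02; A03; A04; A05; A06; A07; A08;
  A09; A10; A11; A12; A13; A14; A15; A16;
  A17; A18; A19; A20; A21; A22; A23; A24;
  C5].

Definition vertex_code (v : vertex) : nat :=
  (match v with
  | A01 => 0 | A02 => 1 | A03 => 2 | A04 => 3 | A05 => 4
  | A06 => 5 | A07 => 6 | A08 => 7 | A09 => 8 | A10 => 9
  | A11 => 10 | A12 => 11 | A13 => 12 | A14 => 13 | A15 => 14
  | A16 => 15 | A17 => 16 | A18 => 17 | A19 => 18 | A20 => 19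
  | A21 => 20 | A22 => 21 | A23 => 22 | A24 => 23 | C5 => 24
  end)%N.

Lemma vertex_codeK : cancel vertex_code (nth C5 vertices).
Proof. by case. Qed.

HB.instance Definition _ := Countable.copy vertex (can_type vertex_codeK).

Lemma vertices_enumP : Finite.axiom vertices.
Proof. by case. Qed.

HB.instance Definition _ := isFinite.Build vertex vertices_enumP.

Section Algebras.
Variable F : fieldType.

Definition basis_vec (k : nat) : 'cV[F]_5 := \col_(i < 5) (i.+1 == k)%:R.

Definition entry (i j : nat) (v : 'cV[F]_5) : (nat * nat) * 'cV[F]_5 :=
  ((i, j), v).

Local Notation e := basis_vec.

(* [entry i j v] stands for e_i e_j = e_j e_i = v, with basis vectors numbered
   from 1.  Each unordered pair {i, j} occurs at most once per algebra, so
   the sum in [alg] has at most one term. *)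
Definition products (v : vertex) : seq ((nat * nat) * 'cV[F]_5) :=
  match v with
  | A01 => [:: entry 1 1 (e 2); entry 2 2 (e 4); entry 1 3 (e 4);
             entry 1 2 (e 3); entry 1 4 (e 5); entry 2 3 (e 5)]
  | A02 => [:: entry 1 1 (e 3); entry 2 2 (e 5); entry 3 3 (e 5);
             entry 1 3 (e 4); entry 1 4 (e 5)]
  | A03 => [:: entry 1 1 (e 3); entry 2 2 (e 4); entry 1 3 (e 5);
             entry 2 4 (e 5)]
  | A04 => [:: entry 1 1 (e 3); entry 1 2 (e 4); entry 1 4 (e 5);
             entry 2 3 (e 5)]
  | A05 => [:: entry 1 1 (e 2); entry 2 2 (e 4); entry 1 2 (e 3);
             entry 1 3 (e 4)]
  | A06 => [:: entry 1 1 (e 2); entry 1 2 (e 3); entry 4 4 (e 5)]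
  | A07 => [:: entry 1 3 (e 4); entry 2 3 (e 5); entry 1 2 (e 4 + e 5)]
  | A08 => [:: entry 1 1 (e 3); entry 2 2 (e 4); entry 1 3 (e 4);
             entry 1 2 (e 5)]
  | A09 => [:: entry 1 3 (e 5); entry 1 2 (e 4); entry 2 3 (- e 5)]
  | A10 => [:: entry 1 1 (e 3); entry 1 3 (e 4); entry 1 2 (e 5)]
  | A11 => [:: entry 1 1 (e 4); entry 2 3 (e 4); entry 1 3 (e 5)]
  | A12 => [:: entry 1 2 (e 4); entry 1 3 (e 5)]
  | A13 => [:: entry 3 3 (e 4); entry 1 2 (e 5); entry 3 4 (e 5)]
  | A14 => [:: entry 1 1 (e 3); entry 2 2 (e 4); entry 1 3 (e 4)]
  | A15 => [:: entry 1 2 (e 3); entry 4 4 (e 5)]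
  | A16 => [:: entry 1 1 (e 3); entry 2 2 (e 5); entry 1 2 (e 4)]
  | A17 => [:: entry 1 1 (e 4); entry 3 3 (e 5); entry 1 2 (e 5)]
  | A18 => [:: entry 1 1 (e 2); entry 1 2 (e 3)]
  | A19 => [:: entry 1 1 (e 3); entry 2 2 (e 4)]
  | A20 => [:: entry 1 1 (e 3); entry 1 2 (e 4)]
  | A21 => [:: entry 2 3 (e 5); entry 1 4 (e 5)]
  | A22 => [:: entry 1 1 (e 4); entry 2 3 (e 4)]
  | A23 => [:: entry 1 2 (e 3)]
  | A24 => [:: entry 1 1 (e 2)]
  | C5 => [::]
  end.

Definition alg (v : vertex) : mult F 5 :=
  [ffun t : 'I_5 * 'I_5 * 'I_5 =>
    \sum_(p <- products v |
           p.1 \in [:: (t.1.1.+1, t.1.2.+1); (t.1.2.+1, t.1.1.+1)])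
      p.2 t.2 0].

End Algebras.

Definition successors (v : vertex) : seq vertex :=
  match v with
  | A01 => [:: A02; A03]
  | A02 => [:: A04; A05; A06; A07]
  | A03 => [:: A04; A06]
  | A04 => [:: A08; A09; A13]
  | A05 => [:: A08]
  | A06 => [:: A08; A09]
  | A07 => [:: A09]
  | A08 => [:: A10; A11; A14; A16]
  | A09 => [:: A11; A15]
  | A10 => [:: A12; A18]
  | A11 => [:: A12; A17; A22]
  | A12 => [:: A20]
  | A13 => [:: A14; A15; A21]
  | A14 => [:: A17; A18]
  | A15 => [:: A17; A22]
  | A16 => [:: A19]
  | A17 => [:: A19; A22]
  | A18 => [:: A20]
  | A19 => [:: A20]
  | A20 => [:: A23]
  | A21 => [:: A22]
  | A22 => [:: A23]
  | A23 => [:: A24]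
  | A24 => [:: C5]
  | C5 => [::]
  end.

Definition edge : rel vertex := fun A B => B \in successors A.

(* Main.v *)
Require Import Defs.
From mathcomp Require Import all_boot all_order all_algebra.
From mathcomp Require Import perm classical_sets mpoly ring.
From mathcomp Require Import reals complex.

(* If A has a basis E_i(t) over C[t, 1/t] whose structure constants lie in C[t]
   and specialize at t = 0 to those of B, then every polynomial vanishing on the
   orbit of A vanishes along a curve through B, so A degenerates to B; such a
   basis is given for each of the 44 edges of the graph.  Degeneration is
   transitive, so all paths give degenerations.

   Conversely, a polynomial identity in vectors and linear forms built from the
   multiplication is equivariant, so it holds on the whole orbit closure of A
   once it holds in A.  Twenty pairs (A, B) are separated by such identities
   (ranks, products of length 3 and 4, discriminants and resultants of the forms
   f(xy) and f(xyz)), and each pair not joined by a path reduces to one of these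
   twenty by transitivity. *)

Set Implicit Arguments.
Unset Strict Implicit.
Unset Printing Implicit Defensive.

Import Order.TTheory GRing.Theory Num.Theory.

Local Open Scope ring_scope.

(** * Zariski closures and regular functions *)

(** A property that separates A from B has to be closed and stable under GL. An existential property
    (some subspace, some basis) is stable but not visibly closed; a condition on coordinates is
    closed but usually stable only under a subgroup. An identity quantified over all vectors and all
    linear forms is both: for fixed arguments it is a polynomial equation in the structure
    constants, and acting by g merely replaces the arguments. Hence each structural feature of A,
    such as a common linear factor of a family of quadratic forms or a repeated root, enters as the
    vanishing of a determinant, discriminant or resultant, and it is refuted in B by a single
    evaluation at basis vectors, with an integer value. Only the degenerations use an algebraically
    closed field: three of the curves involve i, for instance because i e_2 + e_3 has square zero in
    A02. Each curve is recorded as finite integer data with a common denominator, so that all the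
    edges are verified by evaluation. *)

Section Degeneration.
Variables (F : fieldType) (n : nat).
Implicit Types (mu nu lambda : mult F n) (x y : 'cV[F]_n).

Lemma zariski_closureP (X : set (mult F n)) lambda :
  zariski_closure X lambda <->
  forall p, (forall mu, X mu -> eval_mult p mu = 0) -> eval_mult p lambda = 0.
Proof.
split=> [clX p Xp0 | Xvan Z [[S ->] XZ] p Sp].
  apply: (clX [set mu | eval_mult p mu = 0]%classic); split=> //.
  exists [set p]%classic; apply/seteqP; split=> mu /=; first by move=> ? _ ->.
  exact.
by apply: Xvan => mu /XZ; apply.
Qed.

Definition regular (phi : mult F n -> F) :=
  exists p, forall mu, phi mu = eval_mult p mu.

Lemma regular_const c : regular (fun=> c).
Proof. by exists c%:MP => mu; rewrite /eval_mult mevalC. Qed.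

Lemma regular_coord t : regular (fun mu => mu t).
Proof. by exists 'X_(enum_rank t) => mu; rewrite /eval_mult mevalXU enum_rankK. Qed.

Lemma regularD phi psi :
  regular phi -> regular psi -> regular (fun mu => phi mu + psi mu).
Proof.
by move=> [p pE] [q qE]; exists (p + q) => mu; rewrite /eval_mult mevalD pE qE.
Qed.

Lemma regularM phi psi :
  regular phi -> regular psi -> regular (fun mu => phi mu * psi mu).
Proof.
by move=> [p pE] [q qE]; exists (p * q) => mu; rewrite /eval_mult mevalM pE qE.
Qed.

Lemma regularN phi : regular phi -> regular (fun mu => - phi mu).
Proof. by move=> [p pE]; exists (- p) => mu; rewrite /eval_mult mevalN pE. Qed.

Lemma regular_sum I (r : seq I) (phi : I -> mult F n -> F) :
  (forall i, regular (phi i)) -> regular (fun mu => \sum_(i <- r) phi i mu).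
Proof.
move=> phi_reg; elim: r => [|i r [p pE]].
  by exists 0 => mu; rewrite big_nil /eval_mult meval0.
have [q qE] := phi_reg i; exists (q + p) => mu.
by rewrite big_cons pE qE /eval_mult mevalD.
Qed.

Lemma regular_prod I (r : seq I) (phi : I -> mult F n -> F) :
  (forall i, regular (phi i)) -> regular (fun mu => \prod_(i <- r) phi i mu).
Proof.
move=> phi_reg; elim: r => [|i r [p pE]].
  by exists 1 => mu; rewrite big_nil /eval_mult meval1.
have [q qE] := phi_reg i; exists (q * p) => mu.
by rewrite big_cons pE qE /eval_mult mevalM.
Qed.

(** Polynomials pull back along polynomial maps. Applied to [gl_act g], this shows that each g acts
    continuously, which transitivity rests on. *)
Lemma regular_eval_comp p (psi : mult F n -> mult F n) :
  (forall t, regular (fun mu => psi mu t)) ->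
  regular (fun mu => eval_mult p (psi mu)).
Proof.
move=> psi_reg.
have [q qE] : regular (fun mu => \sum_(m <- msupp p)
    p@_m * \prod_i \prod_(k < m i) psi mu (enum_val i)).
  apply: regular_sum => m; apply: regularM; first exact: regular_const.
  by apply: regular_prod => i; apply: regular_prod.
exists q => mu; rewrite -qE /eval_mult mevalE; apply: eq_bigr => m _.
by congr (_ * _); apply: eq_bigr => i _; rewrite prodr_const card_ord.
Qed.

Lemma mulvDl mu x x' y : mulv mu (x + x') y = mulv mu x y + mulv mu x' y.
Proof.
apply/colP => k; rewrite !mxE -big_split; apply: eq_bigr => i _ /=.
by rewrite -big_split; apply: eq_bigr => j _; rewrite !mxE !mulrDl.
Qed.

Lemma mulvDr mu x y y' : mulv mu x (y + y') = mulv mu x y + mulv mu x y'.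
Proof.
apply/colP => k; rewrite !mxE -big_split; apply: eq_bigr => i _ /=.
by rewrite -big_split; apply: eq_bigr => j _; rewrite !mxE mulrDr mulrDl.
Qed.

Lemma mulvZl mu a x y : mulv mu (a *: x) y = a *: mulv mu x y.
Proof.
apply/colP => k; rewrite !mxE mulr_sumr; apply: eq_bigr => i _.
by rewrite mulr_sumr; apply: eq_bigr => j _; rewrite !mxE !mulrA.
Qed.

Lemma mulvZr mu a x y : mulv mu x (a *: y) = a *: mulv mu x y.
Proof.
apply/colP => k; rewrite !mxE mulr_sumr; apply: eq_bigr => i _.
by rewrite mulr_sumr; apply: eq_bigr => j _; rewrite !mxE !mulrA (mulrC a).
Qed.

Lemma mulv0 mu x : mulv mu x 0 = 0.
Proof. by rewrite -[0 in LHS](scale0r 0) mulvZr scale0r. Qed.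

Lemma mul0v mu y : mulv mu 0 y = 0.
Proof. by rewrite -[0 in LHS](scale0r 0) mulvZl scale0r. Qed.

Lemma mulv_suml I (r : seq I) mu (a : I -> F) (u : I -> 'cV_n) y :
  mulv mu (\sum_(i <- r) a i *: u i) y = \sum_(i <- r) a i *: mulv mu (u i) y.
Proof.
elim: r => [|i r IHr]; last by rewrite !big_cons mulvDl mulvZl IHr.
by rewrite !big_nil mul0v.
Qed.

Lemma mulv_sumr I (r : seq I) mu (a : I -> F) (u : I -> 'cV_n) x :
  mulv mu x (\sum_(i <- r) a i *: u i) = \sum_(i <- r) a i *: mulv mu x (u i).
Proof.
elim: r => [|i r IHr]; last by rewrite !big_cons mulvDr mulvZr IHr.
by rewrite !big_nil mulv0.
Qed.

Lemma col_sum_delta x : x = \sum_i x i 0 *: delta_mx i 0.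
Proof. by rewrite [LHS]matrix_sum_delta; apply: eq_bigr => i _; rewrite big_ord1. Qed.

Lemma mulv_delta mu i j k : mulv mu (delta_mx i 0) (delta_mx j 0) k 0 = mu (i, j, k).
Proof.
rewrite mxE (bigD1 i) //= (bigD1 j) //= !mxE !eqxx !mul1r.
rewrite [X in _ + X + _]big1 => [|j' /negPf j'j]; last first.
  by rewrite !mxE j'j !(mulr0, mul0r).
rewrite big1 => [|i' /negPf i'i]; first by rewrite !addr0.
by apply: big1 => j' _; rewrite !mxE i'i !mul0r.
Qed.

Lemma mult_ofK mu : mult_of (mulv mu) = mu.
Proof. by apply/ffunP => -[[i j] k]; rewrite ffunE mulv_delta. Qed.

(** [gl_act] records values on basis vectors only; bilinearity extends the formula to all
    vectors. *)
Lemma mulv_act g mu x y :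
  mulv (gl_act g mu) x y = g *m mulv mu (invmx g *m x) (invmx g *m y).
Proof.
rewrite [x in RHS]col_sum_delta [y in RHS]col_sum_delta !mulmx_sumr.
under eq_bigr do rewrite -scalemxAr.
under [in X in mulv mu _ X]eq_bigr do rewrite -scalemxAr.
rewrite mulv_suml mulmx_sumr; apply/colP => k; rewrite mxE summxE.
apply: eq_bigr => i _; rewrite mulv_sumr -scalemxAr mulmx_sumr !mxE.
rewrite summxE mulr_sumr; apply: eq_bigr => j _.
by rewrite -scalemxAr !mxE ffunE /= !mxE mulrA.
Qed.

Lemma gl_act1 mu : gl_act 1%:M mu = mu.
Proof.
rewrite -[RHS]mult_ofK; apply/ffunP => t.
by rewrite !ffunE invmx1 !mul1mx.
Qed.

Lemma gl_actM g h mu :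
  g \in unitmx -> h \in unitmx -> gl_act (g *m h) mu = gl_act g (gl_act h mu).
Proof.
move=> Ug Uh; apply/ffunP => t; rewrite !ffunE mulv_act.
suff -> : invmx (g *m h) = invmx h *m invmx g by rewrite !mulmxA.
have Ugh : g *m h \in unitmx by rewrite unitmx_mul Ug.
by rewrite -[LHS](mulmxK Ug) -[_ *m g](mulmxK Uh) -(mulmxA _ g h) mulVmx ?mul1mx.
Qed.

Lemma regular_act g t : regular (fun mu => gl_act g mu t).
Proof.
pose phi mu := \sum_k g t.2 k * \sum_i \sum_j
  (invmx g *m delta_mx t.1.1 0 : 'cV_n) i 0 *
  (invmx g *m delta_mx t.1.2 0 : 'cV_n) j 0 * mu (i, j, k).
have [q qE] : regular phi.
  apply: regular_sum => k; apply: regularM; first exact: regular_const.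
  apply: regular_sum => i; apply: regular_sum => j.
  by apply: regularM; [exact: regular_const | exact: regular_coord].
exists q => mu; rewrite -qE ffunE mxE; apply: eq_bigr => k _.
by rewrite [in LHS]mxE.
Qed.

Lemma degenerates_refl mu : degenerates_to mu mu.
Proof.
apply/zariski_closureP => p; apply.
by exists 1%:M; rewrite ?unitmx1 // gl_act1.
Qed.

Lemma degenerates_regular mu lambda phi :
  degenerates_to mu lambda -> regular phi ->
  (forall g, g \in unitmx -> phi (gl_act g mu) = 0) -> phi lambda = 0.
Proof.
move=> /zariski_closureP deg [p pE] phi0; rewrite pE.
by apply: deg => _ [g Ug ->]; rewrite -pE phi0.
Qed.

(** Orbit closures are stable under the group: if [p] vanishes on the orbit of [mu], so does its
    translate by g, hence [p] vanishes on the whole orbit of [nu]. *)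
Lemma degenerates_trans mu nu lambda :
  degenerates_to mu nu -> degenerates_to nu lambda -> degenerates_to mu lambda.
Proof.
move=> deg_mu deg_nu; apply/zariski_closureP => p p0.
apply: (degenerates_regular deg_nu) => [|g Ug]; first by exists p.
apply: (degenerates_regular deg_mu (phi := fun nu => eval_mult p (gl_act g nu))).
  by apply: regular_eval_comp; exact: regular_act.
move=> h Uh; apply: p0; exists (g *m h); first by rewrite unitmx_mul Ug.
by rewrite gl_actM.
Qed.

End Degeneration.

(** * Curves and Laurent polynomials *)

Lemma poly_eq0_nonzero (F : numFieldType) (q : {poly F}) :
  (forall s, s != 0 -> q.[s] = 0) -> q = 0.
Proof.
move=> q0; apply/eqP/negPn/negP => nz_q.
(* In characteristic zero 1, ..., [size q] are distinct nonzero roots, more than the degree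
   allows. *)
pose rs : seq F := [seq k.+1%:R | k <- iota 0 (size q)].
have rs_root : all (root q) rs.
  by apply/allP => _ /mapP[k _ ->]; rewrite /root q0 ?pnatr_eq0.
have rs_uniq : uniq rs.
  by rewrite map_inj_uniq ?iota_uniq // => j k /eqP; rewrite eqr_nat => /eqP[].
by have := max_poly_roots nz_q rs_root rs_uniq; rewrite size_map size_iota ltnn.
Qed.

Lemma curve_degenerates (F : numFieldType) n (mu lambda : mult F n)
    (c : 'I_n * 'I_n * 'I_n -> {poly F}) :
  (forall t, (c t).[0] = lambda t) ->
  (forall s, s != 0 ->
     exists2 g, g \in unitmx & gl_act g mu = [ffun t => (c t).[s]]) ->
  degenerates_to mu lambda.
Proof.
move=> c0 c_orbit; apply/zariski_closureP => p p_orbit.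
pose q := \sum_(m <- msupp p) (p@_m)%:P * \prod_i c (enum_val i) ^+ m i.
have qE s : q.[s] = eval_mult p [ffun t => (c t).[s]].
  rewrite horner_sum /eval_mult mevalE; apply: eq_bigr => m _.
  rewrite hornerCM horner_prod; congr (_ * _); apply: eq_bigr => i _.
  by rewrite horner_exp ffunE.
suff q0 : q = 0.
  suff <- : [ffun t => (c t).[0]] = lambda by rewrite -qE q0 horner0.
  by apply/ffunP => t; rewrite ffunE c0.
apply: poly_eq0_nonzero => s /c_orbit[g Ug gE].
by rewrite qE -gE; apply: p_orbit; exists g.
Qed.

(** Gaussian integers as pairs (real part, imaginary part), so that the certificates involving i can
    still be checked by computation. *)
Definition gaussian : Type := int * int.
Definition gauss_add (z w : gaussian) : gaussian := (z.1 + w.1, z.2 + w.2).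
Definition gauss_mul (z w : gaussian) : gaussian :=
  (z.1 * w.1 - z.2 * w.2, z.1 * w.2 + z.2 * w.1).

(* Lists of monomials (exponent, coefficient); exponents may be repeated. *)
Definition laurent := seq (int * gaussian).
Definition laurent_mul (p q : laurent) : laurent :=
  [seq (m.1 + m'.1, gauss_mul m.2 m'.2) | m <- p, m' <- q].
Definition laurent_const (c : int) : laurent := [:: (0, (c, 0))].
Definition laurent_coef (p : laurent) (e : int) : gaussian :=
  foldr (fun m z => if m.1 == e then gauss_add m.2 z else z) (0, 0) p.
Definition laurent_null (p : laurent) :=
  all (fun m => laurent_coef p m.1 == (0, 0)) p.
Definition laurent_pos (p : laurent) :=
  all (fun m => (laurent_coef p m.1 == (0, 0)) || (0 < m.1)) p.

Section LaurentEval.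
Variable F : numClosedFieldType.
Implicit Types (s : F) (p q : laurent).

Definition gauss_val (z : gaussian) : F := z.1%:~R + 'i * z.2%:~R.

Definition laurent_eval s p : F := \sum_(m <- p) gauss_val m.2 * s ^ m.1.

Lemma gauss_valD z w : gauss_val (gauss_add z w) = gauss_val z + gauss_val w.
Proof. by rewrite /gauss_val /= !intrD; ring. Qed.

Lemma gauss_valM z w : gauss_val (gauss_mul z w) = gauss_val z * gauss_val w.
Proof.
have i2 := sqrCi F; rewrite /gauss_val /= !(intrD, intrM, mulrNz); ring: i2.
Qed.

Lemma laurent_eval_cat s p q :
  laurent_eval s (p ++ q) = laurent_eval s p + laurent_eval s q.
Proof. exact: big_cat. Qed.

Lemma laurent_eval_mul s p q :
  s != 0 -> laurent_eval s (laurent_mul p q) = laurent_eval s p * laurent_eval s q.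
Proof.
move=> nz_s; rewrite /laurent_eval big_allpairs_dep mulr_suml.
apply: eq_bigr => m _; rewrite mulr_sumr; apply: eq_bigr => m' _.
by rewrite /= gauss_valM expfzDr // mulrACA.
Qed.

Lemma laurent_eval_const s c : laurent_eval s (laurent_const c) = c%:~R.
Proof. by rewrite /laurent_eval big_seq1 /gauss_val /= mulr0 addr0 mulr1. Qed.

Lemma laurent_eval_coef s p :
  laurent_eval s p =
  \sum_(e <- undup (map fst p)) gauss_val (laurent_coef p e) * s ^ e.
Proof.
have coefE e : gauss_val (laurent_coef p e) =
    \sum_(m <- p) if m.1 == e then gauss_val m.2 else 0.
  elim: p => [|m p IHp] /=; first by rewrite big_nil /gauss_val /= mulr0 addr0.
  by rewrite big_cons -IHp; case: ifP => _; rewrite ?gauss_valD ?add0r.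
under eq_bigr do rewrite coefE mulr_suml.
rewrite exchange_big; apply: eq_big_seq => m pm /=.
rewrite (bigD1_seq m.1) ?undup_uniq ?mem_undup ?map_f //= eqxx.
by rewrite big1 ?addr0 // => e /negPf em; rewrite eq_sym em mul0r.
Qed.

Lemma laurent_null_eval s p : laurent_null p -> laurent_eval s p = 0.
Proof.
move=> /allP p0; rewrite laurent_eval_coef big_seq big1 // => e.
rewrite mem_undup => /mapP[m /p0/eqP cm ->].
by rewrite cm /gauss_val /= mulr0 addr0 mul0r.
Qed.

(** Terms with exponent at most 0 cancel, so what remains is a polynomial without constant term. It
    is returned as data because the degenerating curve is built from it. *)
Lemma laurent_pos_poly p :
  laurent_pos p ->
  {q : {poly F} | q.[0] = 0 & forall s, laurent_eval s p = q.[s]}.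
Proof.
move=> /allP ppos.
exists (\sum_(e <- undup (map fst p) | (0 < e)%R)
          (gauss_val (laurent_coef p e))%:P * 'X^`|e|%N).
  rewrite horner_sum big1 // => e e_gt0.
  by rewrite hornerCM hornerXn expr0n absz_eq0 gt_eqF // mulr0.
move=> s; rewrite laurent_eval_coef (bigID (fun e : int => 0 < e)) /=.
rewrite [X in _ + X]big_seq_cond [X in _ + X]big1 ?addr0 => [|e].
  rewrite horner_sum; apply: eq_bigr => e e_gt0.
  by rewrite hornerCM hornerXn exprnP gtz0_abs.
rewrite mem_undup => /andP[/mapP[m /ppos /orP[/eqP cm | m_gt0] ->]].
  by rewrite cm /gauss_val /= mulr0 addr0 mul0r.
by rewrite m_gt0.
Qed.

End LaurentEval.

(** * Certificates for degenerations *)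

(* [(i, j, [:: (k, c); ...])] stands for e_i e_j = e_j e_i = c e_k + ...: the
   data of [products] over the integers, hence usable in computations. *)
Definition table (v : vertex) : seq (nat * nat * seq (nat * int)) :=
  let one i j k := ((i, j), [:: (k, 1%R)]) in
  match v with
  | A01 => [:: one 1 1 2; one 2 2 4; one 1 3 4; one 1 2 3; one 1 4 5; one 2 3 5]
  | A02 => [:: one 1 1 3; one 2 2 5; one 3 3 5; one 1 3 4; one 1 4 5]
  | A03 => [:: one 1 1 3; one 2 2 4; one 1 3 5; one 2 4 5]
  | A04 => [:: one 1 1 3; one 1 2 4; one 1 4 5; one 2 3 5]
  | A05 => [:: one 1 1 2; one 2 2 4; one 1 2 3; one 1 3 4]
  | A06 => [:: one 1 1 2; one 1 2 3; one 4 4 5]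
  | A07 => [:: one 1 3 4; one 2 3 5; ((1, 2), [:: (4, 1%R); (5, 1%R)])]
  | A08 => [:: one 1 1 3; one 2 2 4; one 1 3 4; one 1 2 5]
  | A09 => [:: one 1 3 5; one 1 2 4; ((2, 3), [:: (5, (-1)%R)])]
  | A10 => [:: one 1 1 3; one 1 3 4; one 1 2 5]
  | A11 => [:: one 1 1 4; one 2 3 4; one 1 3 5]
  | A12 => [:: one 1 2 4; one 1 3 5]
  | A13 => [:: one 3 3 4; one 1 2 5; one 3 4 5]
  | A14 => [:: one 1 1 3; one 2 2 4; one 1 3 4]
  | A15 => [:: one 1 2 3; one 4 4 5]
  | A16 => [:: one 1 1 3; one 2 2 5; one 1 2 4]
  | A17 => [:: one 1 1 4; one 3 3 5; one 1 2 5]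
  | A18 => [:: one 1 1 2; one 1 2 3]
  | A19 => [:: one 1 1 3; one 2 2 4]
  | A20 => [:: one 1 1 3; one 1 2 4]
  | A21 => [:: one 2 3 5; one 1 4 5]
  | A22 => [:: one 1 1 4; one 2 3 4]
  | A23 => [:: one 1 2 3]
  | A24 => [:: one 1 1 2]
  | C5 => [::]
  end%N.

Lemma table_bounds v :
  all (fun r => [&& 0 < r.1.1 <= 5 & 0 < r.1.2 <= 5]%N) (table v).
Proof. by case: v. Qed.

Section Coordinates.
Variable F : fieldType.
Implicit Types (x y : 'cV[F]_5) (v : vertex).

Lemma productsE v :
  products F v =
  [seq entry r.1.1 r.1.2 (\sum_(q <- r.2) q.2%:~R *: basis_vec F q.1)
     | r <- table v].
Proof. by case: v => /=; rewrite ?(big_cons, big_nil, addr0, scale1r, scaleN1r). Qed.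

(** Numbered from 1, like the basis vectors in the tables. Outside 1, ..., 5 it falls back to the
    first coordinate, whence the bounds on [k] below. *)
Definition ecoord x (k : nat) : F := x (inord k.-1) 0.

Lemma ecoordK x (i : 'I_5) : ecoord x i.+1 = x i 0.
Proof. by rewrite /ecoord inord_val. Qed.

Lemma ecoord_basis i k : (0 < k <= 5)%N -> ecoord (basis_vec F i) k = (k == i)%:R.
Proof. by case: k => // k k_lt; rewrite /ecoord mxE inordK. Qed.

Lemma ecoordD x y k : ecoord (x + y) k = ecoord x k + ecoord y k.
Proof. by rewrite /ecoord mxE. Qed.

Lemma ecoordZ a x k : ecoord (a *: x) k = a * ecoord x k.
Proof. by rewrite /ecoord mxE. Qed.

(** The coefficient with which a table row for the unordered pair {i, j} enters x y; on the diagonal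
    both orders coincide and count once. *)
Definition sym_prod x y (i j : nat) : F :=
  if i == j then ecoord x i * ecoord y i
  else ecoord x i * ecoord y j + ecoord x j * ecoord y i.

Lemma sum_sym_prod x y a b :
  (0 < a <= 5)%N -> (0 < b <= 5)%N ->
  \sum_(i < 5) \sum_(j < 5)
    (if (a, b) \in [:: (i.+1, j.+1); (j.+1, i.+1)] then x i 0 * y j 0 else 0) =
  sym_prod x y a b.
Proof.
case: a b => // a [// | b] a5 b5; rewrite /sym_prod /ecoord /= eqSS.
pose i0 : 'I_5 := inord a; pose j0 : 'I_5 := inord b.
have sum1 (k l : 'I_5) :
    \sum_i \sum_j (if (i == k) && (j == l) then x i 0 * y j 0 else 0)
    = x k 0 * y l 0.
  by rewrite pair_big /= -big_mkcond (big_pred1 (k, l)).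
have eq_i0 (i : 'I_5) : (a == i) = (i == i0) by rewrite -val_eqE /= inordK // eq_sym.
have eq_j0 (i : 'I_5) : (b == i) = (i == j0) by rewrite -val_eqE /= inordK // eq_sym.
case: eqP => [ab | /eqP ab].
  rewrite -sum1; apply: eq_bigr => i _; apply: eq_bigr => j _.
  by rewrite !inE !xpair_eqE !eqSS -ab !eq_i0 [X in _ || X]andbC orbb.
rewrite -!sum1 -big_split; apply: eq_bigr => i _; rewrite -big_split.
apply: eq_bigr => j _ /=.
rewrite !inE !xpair_eqE !eqSS !eq_i0 !eq_j0 -/i0 -/j0 [X in _ || X]andbC.
have nij : i0 != j0 by rewrite -val_eqE /= !inordK.
case: (altP (i =P i0)) => [-> | _] /=; last by rewrite add0r.
by rewrite (negPf nij) orbF /= addr0.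
Qed.

Lemma ecoord_mulv v x y k :
  (0 < k <= 5)%N ->
  ecoord (mulv (alg F v) x y) k =
  \sum_(r <- table v)
     (\sum_(q <- r.2) q.2%:~R * (k == q.1)%:R) * sym_prod x y r.1.1 r.1.2.
Proof.
move=> k5; rewrite {1}/ecoord mxE.
under eq_bigr do under eq_bigr do
  rewrite ffunE productsE big_map big_mkcond mulr_sumr.
under eq_bigr do rewrite exchange_big; rewrite exchange_big.
apply: eq_big_seq => r /(allP (table_bounds v)) /andP[r1 r2] /=.
rewrite -sum_sym_prod // mulr_sumr; apply: eq_bigr => i _.
rewrite mulr_sumr; apply: eq_bigr => j _; rewrite mulrC.
case: ifP => _; last by rewrite mul0r mulr0.
rewrite summxE; congr (_ * _); apply: eq_bigr => q _.
by rewrite mxE; congr (_ * _); exact: ecoord_basis.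
Qed.

End Coordinates.

(** * Symbolic verification of a change of basis over the Laurent polynomials *)

Definition indices : seq nat := iota 1 5.

Definition term (k : nat) (e a b : int) : nat * (int * gaussian) := (k, (e, (a, b))).
Definition columns := seq (seq (nat * (int * gaussian))).

Definition entry_at (M : columns) (i j : nat) : laurent :=
  [seq m.2 | m <- nth [::] M j.-1 & m.1 == i].

Definition laurent_sum (I : Type) (r : seq I) (p : I -> laurent) : laurent :=
  flatten [seq p i | i <- r].

Definition delta_laurent (c : int) (i j : nat) : laurent :=
  if i == j then laurent_const c else [::].

Definition laurent_product (v : vertex) (x y : nat -> laurent) (k : nat) : laurent :=
  laurent_sum (table v) (fun r => laurent_mul
    (laurent_sum r.2 (fun q => delta_laurent q.2 k q.1))
    (if r.1.1 == r.1.2 then laurent_mul (x r.1.1) (y r.1.1)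
     else laurent_mul (x r.1.1) (y r.1.2) ++ laurent_mul (x r.1.2) (y r.1.1))).

(* [(c, P, Q)]: the columns of P are the vectors E_j(t), and P^-1 = Q / c. *)
Definition certificate : Type := int * columns * columns.

(** The second test is Q P = c, which for square matrices makes Q / c the inverse of P. In the
    third, Q applied to E_i E_j gives c times the structure constants of A in the basis E_j(t);
    these may differ from c times those of B only by positive powers of t. Scaling by c avoids
    denominators. *)
Definition certifies (A B : vertex) (cert : certificate) : bool :=
  let: (c, P, Q) := cert in
  let mulQ i (u : nat -> laurent) :=
    laurent_sum indices (fun l => laurent_mul (entry_at Q i l) (u l)) in
  [&& c != 0,
      all (fun i => all (fun j =>
        laurent_null (mulQ i (entry_at P ^~ j) ++ delta_laurent (- c) i j))
        indices) indices
    & all (fun i => all (fun j => all (fun k =>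
        laurent_pos (
          mulQ k (laurent_product A (entry_at P ^~ i) (entry_at P ^~ j)) ++
          laurent_mul (laurent_const (- c))
            (laurent_product B (delta_laurent 1 i) (delta_laurent 1 j) k)))
        indices) indices) indices].

Section Certificates.
Variable F : numClosedFieldType.
Implicit Types (s : F) (A B : vertex).

Lemma laurent_eval_sum s I (r : seq I) p :
  laurent_eval s (laurent_sum r p) = \sum_(i <- r) laurent_eval s (p i).
Proof. by rewrite /laurent_eval big_flatten big_map. Qed.

Lemma laurent_eval_delta s c i j :
  laurent_eval s (delta_laurent c i j) = c%:~R * (i == j)%:R.
Proof.
rewrite /delta_laurent; case: eqP => _; first by rewrite laurent_eval_const mulr1.
by rewrite /laurent_eval big_nil mulr0.
Qed.

Lemma laurent_eval_product s v (p q : nat -> laurent) (x y : 'cV[F]_5) k :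
  s != 0 -> (0 < k <= 5)%N ->
  (forall i, (0 < i <= 5)%N -> ecoord x i = laurent_eval s (p i)) ->
  (forall i, (0 < i <= 5)%N -> ecoord y i = laurent_eval s (q i)) ->
  laurent_eval s (laurent_product v p q k) = ecoord (mulv (alg F v) x y) k.
Proof.
move=> nz_s k5 xE yE; rewrite ecoord_mulv // laurent_eval_sum.
apply: eq_big_seq => r /(allP (table_bounds v)) /andP[r1 r2].
rewrite laurent_eval_mul // laurent_eval_sum; congr (_ * _).
  by apply: eq_bigr => t _; rewrite laurent_eval_delta.
rewrite /sym_prod !xE ?yE //; case: eqP => _; first by rewrite laurent_eval_mul.
by rewrite laurent_eval_cat !laurent_eval_mul.
Qed.

Lemma big_indices (G : nat -> F) :
  \sum_(i <- indices) G i = \sum_(i < 5) G i.+1.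
Proof.
by rewrite /indices (iotaDl 1 0) big_map -(big_mkord xpredT (fun i => G i.+1)).
Qed.

Lemma mem_indices k : (k \in indices) = (0 < k <= 5)%N.
Proof. by rewrite mem_iota. Qed.

Lemma certifies_degenerates A B cert :
  certifies A B cert -> degenerates_to (alg F A) (alg F B).
Proof.
case: cert => [[c P] Q] /and3P[nz_c /allP QP /allP QPP].
have ord_indices (i : 'I_5) : i.+1 \in indices by rewrite mem_indices ltn_ord.
have nz_cF : c%:~R != 0 :> F by rewrite intr_eq0.
(* [d t] is a polynomial vanishing at 0: c times the difference between the curve and B. *)
pose d (t : 'I_5 * 'I_5 * 'I_5) := laurent_pos_poly F
  (allP (allP (QPP _ (ord_indices t.1.1)) _ (ord_indices t.1.2)) _ (ord_indices t.2)).
pose curve t := (c%:~R^-1)%:P * s2val (d t) + (alg F B t)%:P.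
apply: (curve_degenerates (c := curve)) => [t | s nz_s].
  by rewrite /curve hornerD hornerCM hornerC (s2valP (d t)) mulr0 add0r.
pose Pm : 'M[F]_5 := \matrix_(i, j) laurent_eval s (entry_at P i.+1 j.+1).
pose Qm : 'M[F]_5 := \matrix_(i, j) laurent_eval s (entry_at Q i.+1 j.+1).
have QmPm : (c%:~R^-1 *: Qm) *m Pm = 1%:M.
  apply/matrixP => i j; rewrite -scalemxAl !mxE.
  have /(laurent_null_eval s) := allP (QP _ (ord_indices i)) _ (ord_indices j).
  rewrite laurent_eval_cat laurent_eval_delta laurent_eval_sum big_indices.
  rewrite mulrNz mulNr => /eqP; rewrite subr_eq0 => /eqP QPij.
  apply: (mulfI nz_cF); rewrite mulVKf // eqSS val_eqE in QPij *.
  rewrite -QPij; apply: eq_bigr => l _.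
  by rewrite !mxE laurent_eval_mul.
have [Ug UP] := mulmx1_unit QmPm.
have invg : invmx (c%:~R^-1 *: Qm) = Pm.
  by rewrite -[LHS]mulmx1 -QmPm mulKmx.
(* The group element is P^-1, not P: the structure constants of A in the basis formed by the columns
   of P are those of P^-1 acting on A. *)
exists (c%:~R^-1 *: Qm) => //.
apply/ffunP => -[[i j] k]; rewrite !ffunE /= invg -scalemxAl mxE.
rewrite /curve hornerD hornerCM hornerC -(s2valP' (d (i, j, k))).
rewrite laurent_eval_cat laurent_eval_sum big_indices laurent_eval_mul //=.
have ecoord_delta (l : 'I_5) m : (0 < m <= 5)%N ->
    ecoord (delta_mx l 0 : 'cV[F]_5) m = laurent_eval s (delta_laurent 1 l.+1 m).
  case: m => // m m5; rewrite laurent_eval_delta mul1r eqSS /ecoord mxE andbT.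
  by rewrite -val_eqE /= inordK // eq_sym.
have ecoord_P (l : 'I_5) m : (0 < m <= 5)%N ->
    ecoord (Pm *m delta_mx l 0) m = laurent_eval s (entry_at P m l.+1).
  by case: m => // m m5; rewrite -colE /ecoord !mxE inordK.
rewrite laurent_eval_const.
rewrite (laurent_eval_product _ nz_s _ (ecoord_delta i) (ecoord_delta j)); last first.
  exact: (ltn_ord k).
rewrite (ecoordK _ k) mulv_delta mulrDr mulrNz mulNr mulrN mulKf // subrK.
congr (_ * _); rewrite mxE; apply: eq_bigr => l _.
rewrite mxE laurent_eval_mul // -ecoordK.
by rewrite (laurent_eval_product _ nz_s _ (ecoord_P i) (ecoord_P j)) //;
  exact: (ltn_ord l).
Qed.

End Certificates.

(* [e k] is e_k, [t k n a] is a t^n e_k and [ti k n a] is a i t^n e_k. *)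
Definition edge_certificate (A B : vertex) : certificate :=
  let e k := term k 0 1 0 in
  let t k n a := term k n a 0 in
  let ti k n a := term k n 0 a in
  match A, B with
  | A01, A02 => (1,
      [:: [:: e 1]; [:: ti 2 0 1; t 3 (-1) (-1); ti 4 (-2) (-1); t 5 (-3) 1];
      [:: e 2]; [:: e 3]; [:: e 4]],
      [:: [:: e 1]; [:: e 3]; [:: e 4]; [:: e 5]; [:: t 2 3 1; ti 3 3 (-1);
      t 4 2 1; ti 5 1 1]])
  | A01, A03 => (1,
      [:: [:: e 1]; [:: e 1; t 2 (-1) (-1); t 3 (-2) 1; t 4 (-3) (-1);
      t 5 (-4) 1]; [:: e 2]; [:: e 2; t 3 (-1) (-2); t 4 (-2) 3;
      t 5 (-3) (-4)]; [:: e 3]],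
      [:: [:: e 1]; [:: e 3]; [:: e 5]; [:: t 1 3 4; t 2 3 (-4); t 3 2 (-3);
      t 4 2 (-1); t 5 1 2]; [:: t 1 4 3; t 2 4 (-3); t 3 3 (-2); t 4 3 (-1);
      t 5 2 1]])
  | A02, A04 => (1,
      [:: [:: t 1 1 1]; [:: ti 2 0 1; e 3]; [:: t 3 2 1]; [:: t 4 1 1];
      [:: t 5 2 1]],
      [:: [:: t 1 (-1) 1]; [:: ti 2 0 (-1); ti 3 (-2) 1]; [:: t 3 (-2) 1];
      [:: t 4 (-1) 1]; [:: t 5 (-2) 1]])
  | A02, A05 => (1,
      [:: [:: e 1]; [:: e 3]; [:: e 4]; [:: e 5]; [:: t 2 1 1]],
      [:: [:: e 1]; [:: t 5 (-1) 1]; [:: e 2]; [:: e 3]; [:: e 4]])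
  | A02, A06 => (1,
      [:: [:: e 1]; [:: e 3]; [:: e 4]; [:: t 2 (-1) 1]; [:: t 5 (-2) 1]],
      [:: [:: e 1]; [:: t 4 1 1]; [:: e 2]; [:: e 3]; [:: t 5 2 1]])
  | A02, A07 => (8,
      [:: [:: t 1 1 (-1); ti 2 0 (-2); t 4 (-1) (-2)]; [:: t 1 1 1;
      ti 2 0 (-2); t 4 (-1) 2]; [:: ti 2 0 (-2); t 3 0 (-2)]; [:: t 4 1 2;
      t 5 0 (-4)]; [:: t 4 1 (-2); t 5 0 (-4)]],
      [:: [:: t 1 (-1) (-4); t 2 (-1) 4; t 4 (-3) (-4); t 5 (-3) 4];
      [:: ti 1 0 2; ti 2 0 2]; [:: t 1 0 2; t 2 0 2; t 3 0 (-4)];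
      [:: t 4 (-1) 2; t 5 (-1) (-2)]; [:: t 4 0 (-1); t 5 0 (-1)]])
  | A03, A04 => (2,
      [:: [:: e 1; t 2 0 (-1)]; [:: t 1 1 1; t 2 1 1]; [:: e 3; e 4];
      [:: t 3 1 1; t 4 1 (-1)]; [:: t 5 1 2]],
      [:: [:: e 1; t 2 (-1) 1]; [:: t 1 0 (-1); t 2 (-1) 1]; [:: e 3;
      t 4 (-1) 1]; [:: e 3; t 4 (-1) (-1)]; [:: t 5 (-1) 1]])
  | A03, A06 => (1,
      [:: [:: e 1]; [:: e 3]; [:: e 5]; [:: t 2 1 1]; [:: t 4 2 1]],
      [:: [:: e 1]; [:: t 4 (-1) 1]; [:: e 2]; [:: t 5 (-2) 1]; [:: e 3]])
  | A04, A08 => (6,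
      [:: [:: e 1; t 2 0 2]; [:: t 2 1 1; t 3 (-1) 3]; [:: e 3; t 4 0 4];
      [:: t 5 0 6]; [:: t 4 1 1; t 5 (-1) 6]],
      [:: [:: t 1 0 6; t 2 (-1) (-12); t 3 (-2) 36; t 4 (-4) 144;
      t 5 (-3) (-144)]; [:: t 2 (-1) 6; t 3 (-2) (-18); t 4 (-4) (-72);
      t 5 (-3) 72]; [:: t 3 0 6; t 4 (-2) 24; t 5 (-1) (-24)];
      [:: t 4 (-2) (-6); t 5 (-1) 6]; [:: e 4]])
  | A04, A09 => (6,
      [:: [:: t 1 1 2; t 2 1 1]; [:: t 2 1 (-3)]; [:: e 3; e 4];
      [:: t 4 2 (-6)]; [:: t 5 1 3]],
      [:: [:: t 1 (-1) 3; t 2 (-1) 1]; [:: t 2 (-1) (-2)]; [:: t 3 0 6;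
      t 4 (-2) 1]; [:: t 4 (-2) (-1)]; [:: t 5 (-1) 2]])
  | A04, A13 => (9,
      [:: [:: t 2 1 1]; [:: t 3 (-1) 3; t 4 (-1) (-3)]; [:: e 1; e 2];
      [:: e 3; t 4 0 2]; [:: t 5 0 3]],
      [:: [:: t 1 (-1) (-9); t 3 0 9]; [:: t 1 (-1) 9]; [:: t 2 1 2; t 4 0 3];
      [:: t 2 1 (-1); t 4 0 3]; [:: t 5 0 3]])
  | A05, A08 => (1,
      [:: [:: t 1 1 1]; [:: e 2; t 3 (-3) (-1); e 5]; [:: t 2 2 1];
      [:: t 3 3 1]; [:: t 3 1 1; t 4 (-2) (-1)]],
      [:: [:: t 1 (-1) 1]; [:: t 3 (-2) 1]; [:: t 4 (-3) 1]; [:: e 4;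
      t 5 2 (-1)]; [:: e 2; t 3 (-2) (-1); t 4 (-6) 1]])
  | A06, A08 => (1,
      [:: [:: e 1; e 4]; [:: t 2 (-1) (-1); t 4 1 1]; [:: e 2; e 5]; [:: e 3];
      [:: t 3 (-1) (-1); t 5 1 1]],
      [:: [:: e 1; t 2 (-1) (-1); t 3 (-2) (-1); t 4 (-4) 1; t 5 (-3) 1];
      [:: e 3; t 4 (-2) (-1); t 5 (-1) (-1)]; [:: e 4]; [:: t 2 (-1) 1;
      t 3 (-2) 1; t 4 (-4) (-1); t 5 (-3) (-1)]; [:: t 4 (-2) 1; t 5 (-1) 1]])
  | A06, A09 => (2,
      [:: [:: t 1 1 1; t 4 1 1]; [:: t 1 1 (-1); t 4 1 1]; [:: e 2; e 5];
      [:: t 2 2 (-1); t 5 2 1]; [:: t 3 1 1]],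
      [:: [:: t 1 (-1) 1; t 2 (-1) (-1)]; [:: e 3; t 4 (-2) (-1)];
      [:: t 5 (-1) 2]; [:: t 1 (-1) 1; t 2 (-1) 1]; [:: e 3; t 4 (-2) 1]])
  | A07, A09 => (1,
      [:: [:: e 1]; [:: e 2]; [:: t 3 1 1]; [:: e 4; e 5]; [:: t 4 1 1]],
      [:: [:: e 1]; [:: e 2]; [:: t 3 (-1) 1]; [:: t 5 (-1) 1]; [:: e 4;
      t 5 (-1) (-1)]])
  | A08, A10 => (1,
      [:: [:: e 1]; [:: t 2 1 1]; [:: e 3]; [:: e 4]; [:: t 5 1 1]],
      [:: [:: e 1]; [:: t 2 (-1) 1]; [:: e 3]; [:: e 4]; [:: t 5 (-1) 1]])
  | A08, A11 => (1,
      [:: [:: e 2]; [:: t 3 (-1) 1]; [:: t 1 1 1]; [:: e 4]; [:: t 5 1 1]],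
      [:: [:: t 3 (-1) 1]; [:: e 1]; [:: t 2 1 1]; [:: e 4]; [:: t 5 (-1) 1]])
  | A08, A14 => (1,
      [:: [:: e 1]; [:: e 2]; [:: e 3]; [:: e 4]; [:: t 5 (-1) 1]],
      [:: [:: e 1]; [:: e 2]; [:: e 3]; [:: e 4]; [:: t 5 1 1]])
  | A08, A16 => (1,
      [:: [:: t 1 1 1]; [:: e 2]; [:: t 3 2 1]; [:: t 5 1 1]; [:: e 4]],
      [:: [:: t 1 (-1) 1]; [:: e 2]; [:: t 3 (-2) 1]; [:: e 5];
      [:: t 4 (-1) 1]])
  | A09, A11 => (2,
      [:: [:: e 1; e 2; t 3 (-1) 1]; [:: e 3]; [:: t 2 (-1) (-2)];
      [:: t 4 0 2]; [:: t 4 (-1) (-2); t 5 (-2) 2]],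
      [:: [:: t 1 0 2; t 2 (-1) (-2); t 3 1 1]; [:: t 3 1 (-1)]; [:: t 2 0 2];
      [:: e 4]; [:: t 4 1 1; t 5 2 1]])
  | A09, A15 => (2,
      [:: [:: t 1 1 1; t 2 1 (-1)]; [:: e 3]; [:: t 5 1 2]; [:: e 1; e 2];
      [:: t 4 0 2]],
      [:: [:: t 1 (-1) 1; e 4]; [:: t 1 (-1) (-1); e 4]; [:: t 2 0 2];
      [:: e 5]; [:: t 3 (-1) 1]])
  | A10, A12 => (1,
      [:: [:: t 1 1 1]; [:: e 3]; [:: e 2]; [:: t 4 1 1]; [:: t 5 1 1]],
      [:: [:: t 1 (-1) 1]; [:: e 3]; [:: e 2]; [:: t 4 (-1) 1];
      [:: t 5 (-1) 1]])
  | A10, A18 => (1,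
      [:: [:: e 1]; [:: e 3]; [:: e 4]; [:: t 2 1 1]; [:: e 5]],
      [:: [:: e 1]; [:: t 4 (-1) 1]; [:: e 2]; [:: e 3]; [:: e 5]])
  | A11, A12 => (1,
      [:: [:: e 3]; [:: e 2]; [:: t 1 1 1]; [:: e 4]; [:: t 5 1 1]],
      [:: [:: t 3 (-1) 1]; [:: e 2]; [:: e 1]; [:: e 4]; [:: t 5 (-1) 1]])
  | A11, A17 => (4,
      [:: [:: t 1 (-1) 2; t 2 (-2) (-2); e 3]; [:: e 2]; [:: e 1;
      t 2 (-1) (-2)]; [:: t 5 (-1) 4]; [:: e 4]],
      [:: [:: t 2 (-1) 8; t 3 0 4]; [:: t 2 0 4]; [:: t 1 0 4; t 2 (-2) (-8);
      t 3 (-1) (-8)]; [:: t 5 0 4]; [:: t 4 1 1]])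
  | A11, A22 => (1,
      [:: [:: e 1]; [:: e 2]; [:: e 3]; [:: e 4]; [:: t 5 (-1) 1]],
      [:: [:: e 1]; [:: e 2]; [:: e 3]; [:: e 4]; [:: t 5 1 1]])
  | A12, A20 => (2,
      [:: [:: e 1; e 2]; [:: e 3]; [:: t 4 0 2]; [:: e 5]; [:: t 2 1 1]],
      [:: [:: t 1 0 2; t 5 (-1) (-2)]; [:: t 5 (-1) 2]; [:: t 2 0 2];
      [:: e 3]; [:: t 4 0 2]])
  | A13, A14 => (8,
      [:: [:: t 3 0 2]; [:: t 1 0 2; t 2 0 2]; [:: t 4 0 4]; [:: t 5 0 8];
      [:: t 1 1 1]],
      [:: [:: t 5 (-1) 8]; [:: t 2 0 4; t 5 (-1) (-8)]; [:: t 1 0 4];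
      [:: t 3 0 2]; [:: e 4]])
  | A13, A15 => (1,
      [:: [:: e 1]; [:: e 2]; [:: e 5]; [:: t 3 1 1]; [:: t 4 2 1]],
      [:: [:: e 1]; [:: e 2]; [:: t 4 (-1) 1]; [:: t 5 (-2) 1]; [:: e 3]])
  | A13, A21 => (1,
      [:: [:: t 3 1 1]; [:: e 1]; [:: e 2]; [:: t 4 (-1) 1]; [:: e 5]],
      [:: [:: e 2]; [:: e 3]; [:: t 1 (-1) 1]; [:: t 4 1 1]; [:: e 5]])
  | A14, A17 => (1,
      [:: [:: t 1 1 1]; [:: t 3 1 1; e 5]; [:: t 2 1 1]; [:: t 3 2 1];
      [:: t 4 2 1]],
      [:: [:: t 1 (-1) 1]; [:: t 3 (-1) 1]; [:: t 4 (-2) 1]; [:: t 5 (-2) 1];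
      [:: e 2; t 4 (-1) (-1)]])
  | A14, A18 => (1,
      [:: [:: e 1]; [:: e 3]; [:: e 4]; [:: t 2 1 1]; [:: e 5]],
      [:: [:: e 1]; [:: t 4 (-1) 1]; [:: e 2]; [:: e 3]; [:: e 5]])
  | A15, A17 => (4,
      [:: [:: e 1; t 2 (-2) 2; t 4 (-1) 2]; [:: t 2 0 (-1)]; [:: t 2 (-1) 2;
      e 4]; [:: t 3 (-2) 4; t 5 (-2) 4]; [:: e 5]],
      [:: [:: t 1 0 4; t 2 (-2) (-8); t 3 (-1) (-8)]; [:: t 2 0 (-4)];
      [:: t 4 2 1; t 5 0 (-4)]; [:: t 2 (-1) 8; t 3 0 4]; [:: t 5 0 4]])
  | A15, A22 => (1,
      [:: [:: e 4]; [:: e 1]; [:: e 2]; [:: e 5]; [:: t 3 (-1) 1;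
      t 5 (-1) (-1)]],
      [:: [:: e 2]; [:: e 3]; [:: e 4; t 5 1 1]; [:: e 1]; [:: e 4]])
  | A16, A19 => (1,
      [:: [:: e 1]; [:: e 2]; [:: e 3]; [:: e 5]; [:: t 4 (-1) 1]],
      [:: [:: e 1]; [:: e 2]; [:: e 3]; [:: t 5 1 1]; [:: e 4]])
  | A17, A19 => (1,
      [:: [:: e 1]; [:: e 3]; [:: e 4]; [:: e 5]; [:: t 2 1 1]],
      [:: [:: e 1]; [:: t 5 (-1) 1]; [:: e 2]; [:: e 3]; [:: e 4]])
  | A17, A22 => (1,
      [:: [:: e 3]; [:: e 1]; [:: e 2]; [:: e 5]; [:: t 4 (-1) 1]],
      [:: [:: e 2]; [:: e 3]; [:: e 1]; [:: t 5 1 1]; [:: e 4]])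
  | A18, A20 => (1,
      [:: [:: t 1 1 1]; [:: e 2; e 4]; [:: t 2 2 1]; [:: t 3 1 1]; [:: e 5]],
      [:: [:: t 1 (-1) 1]; [:: t 3 (-2) 1]; [:: t 4 (-1) 1]; [:: e 2;
      t 3 (-2) (-1)]; [:: e 5]])
  | A19, A20 => (1,
      [:: [:: e 1; e 2]; [:: t 2 1 1]; [:: e 3; e 4]; [:: t 4 1 1]; [:: e 5]],
      [:: [:: e 1; t 2 (-1) (-1)]; [:: t 2 (-1) 1]; [:: e 3; t 4 (-1) (-1)];
      [:: t 4 (-1) 1]; [:: e 5]])
  | A20, A23 => (1,
      [:: [:: e 1]; [:: e 2]; [:: e 4]; [:: t 3 (-1) 1]; [:: e 5]],
      [:: [:: e 1]; [:: e 2]; [:: t 4 1 1]; [:: e 3]; [:: e 5]])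
  | A21, A22 => (2,
      [:: [:: e 1; e 4]; [:: t 2 0 2]; [:: e 3]; [:: t 5 0 2]; [:: t 1 1 1]],
      [:: [:: t 5 (-1) 2]; [:: e 2]; [:: t 3 0 2]; [:: t 1 0 2;
      t 5 (-1) (-2)]; [:: e 4]])
  | A22, A23 => (1,
      [:: [:: e 2]; [:: e 3]; [:: e 4]; [:: t 1 1 1]; [:: e 5]],
      [:: [:: t 4 (-1) 1]; [:: e 1]; [:: e 2]; [:: e 3]; [:: e 5]])
  | A23, A24 => (2,
      [:: [:: e 1; e 2]; [:: t 3 0 2]; [:: t 1 1 1]; [:: e 4]; [:: e 5]],
      [:: [:: t 3 (-1) 2]; [:: t 1 0 2; t 3 (-1) (-2)]; [:: e 2];
      [:: t 4 0 2]; [:: t 5 0 2]])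
  | A24, C5 => (1,
      [:: [:: t 1 1 1]; [:: t 2 1 1]; [:: t 3 1 1]; [:: t 4 1 1];
      [:: t 5 1 1]],
      [:: [:: t 1 (-1) 1]; [:: t 2 (-1) 1]; [:: t 3 (-1) 1]; [:: t 4 (-1) 1];
      [:: t 5 (-1) 1]])
  | _, _ => (0, [::], [::])
  end.

Lemma edge_certificates_valid :
  all (fun A => all (fun B => certifies A B (edge_certificate A B)) (successors A))
    vertices.
Proof. by vm_compute. Qed.

Lemma edge_degenerates (F : numClosedFieldType) A B :
  edge A B -> degenerates_to (alg F A) (alg F B).
Proof.
move=> AB; apply: (@certifies_degenerates _ _ _ (edge_certificate A B)).
apply: (allP (allP edge_certificates_valid A _) B AB).
by case: A {AB}.
Qed.

Lemma connect_degenerates (F : numClosedFieldType) A B :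
  connect edge A B -> degenerates_to (alg F A) (alg F B).
Proof.
move=> /connectP[p + ->] {B}; elim: p A => [|C p IHp] A /=.
  by move=> _; exact: degenerates_refl.
by move=> /andP[/(@edge_degenerates F) degAC /IHp]; exact: degenerates_trans degAC.
Qed.

(** * Polynomial identities *)

Section Concomitants.
Variables (F : fieldType) (n : nat).
Implicit Types (mu nu lambda : mult F n).

Definition vectors := nat -> 'cV[F]_n.
Definition forms := nat -> 'rV[F]_n.

Definition pairing (f : 'rV[F]_n) (x : 'cV[F]_n) : F := (f *m x) 0 0.

(** The classical notion: an invariant of the algebra together with vectors and linear forms, which
    transform contragrediently. Regularity is in the algebra alone, the arguments being fixed when a
    closure is taken. *)
Definition concomitant (Phi : mult F n -> vectors -> forms -> F) :=
  (forall x f, regular (fun mu => Phi mu x f)) /\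
  (forall g mu x f, g \in unitmx ->
     Phi (gl_act g mu) x f = Phi mu (fun i => invmx g *m x i) (fun i => f i *m g)).

Definition vector_concomitant (Psi : mult F n -> vectors -> forms -> 'cV[F]_n) :=
  (forall x f k, regular (fun mu => Psi mu x f k 0)) /\
  (forall g mu x f, g \in unitmx ->
     Psi (gl_act g mu) x f =
     g *m Psi mu (fun i => invmx g *m x i) (fun i => f i *m g)).

Lemma concomitant_degenerates Phi mu lambda :
  concomitant Phi -> degenerates_to mu lambda ->
  (forall x f, Phi mu x f = 0) -> forall x f, Phi lambda x f = 0.
Proof.
move=> [Phi_reg PhiE] deg Phi0 x f.
by apply: (degenerates_regular deg (Phi_reg x f)) => g Ug; rewrite PhiE.
Qed.

Lemma vector_concomitant_var i : vector_concomitant (fun _ x _ => x i).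
Proof.
by split=> [x f k | g mu x f Ug]; [exact: regular_const | rewrite mulKVmx].
Qed.

Lemma vector_concomitant_mul Psi Psi' :
  vector_concomitant Psi -> vector_concomitant Psi' ->
  vector_concomitant (fun mu x f => mulv mu (Psi mu x f) (Psi' mu x f)).
Proof.
move=> [Psi_reg PsiE] [Psi'_reg Psi'E]; split=> [x f k | g mu x f Ug].
  have [q qE] : regular (fun mu => \sum_i \sum_j
      Psi mu x f i 0 * Psi' mu x f j 0 * mu (i, j, k)).
    apply: regular_sum => i; apply: regular_sum => j.
    by apply: regularM; [apply: regularM | exact: regular_coord].
  by exists q => mu; rewrite -qE mxE.
by rewrite mulv_act PsiE // Psi'E // !mulKmx.
Qed.

Lemma vector_concomitantD Psi Psi' :
  vector_concomitant Psi -> vector_concomitant Psi' ->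
  vector_concomitant (fun mu x f => Psi mu x f + Psi' mu x f).
Proof.
move=> [Psi_reg PsiE] [Psi'_reg Psi'E]; split=> [x f k | g mu x f Ug].
  have [q qE] := regularD (Psi_reg x f k) (Psi'_reg x f k).
  by exists q => mu; rewrite -qE mxE.
by rewrite PsiE // Psi'E // mulmxDr.
Qed.

Lemma vector_concomitantZ Phi Psi :
  concomitant Phi -> vector_concomitant Psi ->
  vector_concomitant (fun mu x f => Phi mu x f *: Psi mu x f).
Proof.
move=> [Phi_reg PhiE] [Psi_reg PsiE]; split=> [x f k | g mu x f Ug].
  have [q qE] := regularM (Phi_reg x f) (Psi_reg x f k).
  by exists q => mu; rewrite -qE mxE.
by rewrite PsiE // PhiE // scalemxAr.
Qed.

Lemma concomitant_pairing i Psi :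
  vector_concomitant Psi -> concomitant (fun mu x f => pairing (f i) (Psi mu x f)).
Proof.
move=> [Psi_reg PsiE]; split=> [x f | g mu x f Ug].
  have [q qE] : regular (fun mu => \sum_k f i 0 k * Psi mu x f k 0).
    by apply: regular_sum => k; apply: regularM; [exact: regular_const |].
  by exists q => mu; rewrite -qE /pairing mxE.
by rewrite /pairing PsiE // mulmxA.
Qed.

Lemma concomitant_const c : concomitant (fun _ _ _ => c).
Proof. by split=> // x f; exact: regular_const. Qed.

Lemma concomitantD Phi Phi' :
  concomitant Phi -> concomitant Phi' ->
  concomitant (fun mu x f => Phi mu x f + Phi' mu x f).
Proof.
move=> [Phi_reg PhiE] [Phi'_reg Phi'E].
by split=> [x f | g mu x f Ug]; [exact: regularD | rewrite PhiE ?Phi'E].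
Qed.

Lemma concomitantN Phi :
  concomitant Phi -> concomitant (fun mu x f => - Phi mu x f).
Proof.
move=> [Phi_reg PhiE].
by split=> [x f | g mu x f Ug]; [exact: regularN | rewrite PhiE].
Qed.

Lemma concomitantM Phi Phi' :
  concomitant Phi -> concomitant Phi' ->
  concomitant (fun mu x f => Phi mu x f * Phi' mu x f).
Proof.
move=> [Phi_reg PhiE] [Phi'_reg Phi'E].
by split=> [x f | g mu x f Ug]; [exact: regularM | rewrite PhiE ?Phi'E].
Qed.

Lemma concomitantX Phi m :
  concomitant Phi -> concomitant (fun mu x f => Phi mu x f ^+ m).
Proof.
move=> [Phi_reg PhiE]; split=> [x f | g mu x f Ug]; last by rewrite PhiE.
have [q qE] := Phi_reg x f; exists (q ^+ m) => mu.
by rewrite qE /eval_mult rmorphXn.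
Qed.

Lemma concomitant_det m (Phi : 'I_m -> 'I_m -> mult F n -> vectors -> forms -> F) :
  (forall i j, concomitant (Phi i j)) ->
  concomitant (fun mu x f => \det (\matrix_(i, j) Phi i j mu x f)).
Proof.
move=> Phi_con; split=> [x f | g mu x f Ug].
  have [q qE] : regular (fun mu =>
      \sum_(s : 'S_m) (-1) ^+ s * \prod_i Phi i (s i) mu x f).
    apply: regular_sum => s; apply: regularM; first exact: regular_const.
    by apply: regular_prod => i; exact: (Phi_con i (s i)).1.
  exists q => mu; rewrite -qE; apply: eq_bigr => s _; congr (_ * _).
  by apply: eq_bigr => i _; rewrite mxE.
congr (\det _); apply/matrixP => i j; rewrite !mxE.
exact: (Phi_con i j).2.
Qed.

End Concomitants.

Ltac concomitant :=
  repeat first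
    [ exact: vector_concomitant_var | exact: concomitant_const
    | apply: concomitant_pairing | apply: concomitantN | apply: concomitantD
    | apply: concomitantM | apply: concomitantX | apply: vector_concomitant_mul
    | apply: vector_concomitantD | apply: vector_concomitantZ
    | apply: concomitant_det => ? ? ].

Lemma det_mulmx_lt (F : fieldType) m r (A : 'M[F]_(m, r)) (B : 'M[F]_(r, m)) :
  (r < m)%N -> \det (A *m B) = 0.
Proof.
move=> r_lt_m; apply/eqP; apply: contraTT r_lt_m; rewrite -leqNgt => nz_det.
have /mxrank_unit <- : A *m B \in unitmx by rewrite unitmxE unitfE.
exact: leq_trans (mxrankM_maxl _ _) (rank_leq_col _).
Qed.

(** * Linear forms evaluated on products, and determinants of bounded rank *)

Section AlgebraForms.
Variable F : fieldType.
Implicit Types (f : 'rV[F]_5) (x y : 'cV[F]_5).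

Definition fcoord f k : F := f 0 (inord k.-1).

Definition basis_form k : 'rV[F]_5 := (basis_vec F k)^T.

Lemma fcoord_basis i k : (0 < k <= 5)%N -> fcoord (basis_form i) k = (k == i)%:R.
Proof. by move=> k5; rewrite -ecoord_basis // /fcoord mxE. Qed.

Lemma pairingE f x : pairing f x = \sum_(k <- indices) fcoord f k * ecoord x k.
Proof.
rewrite /indices (iotaDl 1 0) big_map -[iota _ _]/(index_iota 0 5).
rewrite big_mkord /pairing mxE; apply: eq_bigr => i _.
by rewrite /fcoord /ecoord /= inord_val.
Qed.

Lemma table_targets v : all (fun r => all (fun q => q.1 \in indices) r.2) (table v).
Proof. by case: v. Qed.

Lemma pairing_mulv v f x y :
  pairing f (mulv (alg F v) x y) =
  \sum_(r <- table v) (\sum_(q <- r.2) q.2%:~R * fcoord f q.1) *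
                      sym_prod x y r.1.1 r.1.2.
Proof.
rewrite pairingE; transitivity (\sum_(k <- indices) \sum_(r <- table v)
    (\sum_(q <- r.2) q.2%:~R * (k == q.1)%:R) * sym_prod x y r.1.1 r.1.2 * fcoord f k).
  apply: eq_big_seq => k; rewrite mem_indices => k5.
  by rewrite ecoord_mulv // mulr_sumr; apply: eq_bigr => r _; rewrite mulrC.
rewrite exchange_big; apply: eq_big_seq => r /(allP (table_targets v)) /allP rP /=.
under eq_bigr do rewrite mulrAC !mulr_suml.
rewrite exchange_big mulr_suml; apply: eq_big_seq => q /rP q5 /=.
rewrite (bigD1_seq q.1) //= eqxx mulr1 big1 ?addr0 // => k /negPf ->.
by rewrite mulr0 !mul0r.
Qed.

Lemma big_foldr I (r : seq I) (G : I -> F) :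
  \sum_(i <- r) G i = foldr (fun i s => G i + s) 0 r.
Proof. by elim: r => [|i r IHr]; rewrite ?big_nil // big_cons IHr. Qed.

(** On a concrete table the [foldr] reduces to an explicit polynomial in the coordinates, which
    [ring] can treat. *)
Lemma pairing_mulv_foldr v f x y :
  pairing f (mulv (alg F v) x y) =
  foldr (fun r s =>
      foldr (fun q c => q.2%:~R * fcoord f q.1 + c) 0 r.2 *
      sym_prod x y r.1.1 r.1.2 + s)
    0 (table v).
Proof.
rewrite pairing_mulv big_foldr; elim: (table v) => //= r s <-.
by rewrite big_foldr.
Qed.

Lemma ecoord_mulv_foldr v x y k :
  (0 < k <= 5)%N ->
  ecoord (mulv (alg F v) x y) k =
  foldr (fun r s =>
      foldr (fun q c => q.2%:~R * (k == q.1)%:R + c) 0 r.2 *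
      sym_prod x y r.1.1 r.1.2 + s)
    0 (table v).
Proof.
move=> k5; rewrite ecoord_mulv // big_foldr; elim: (table v) => //= r s <-.
by rewrite big_foldr.
Qed.

Lemma pairingD f x y : pairing f (x + y) = pairing f x + pairing f y.
Proof. by rewrite /pairing mulmxDr mxE. Qed.

Lemma pairing0 f : pairing f 0 = 0.
Proof. by rewrite /pairing mulmx0 mxE. Qed.

Lemma pairing_basis i j :
  (0 < i <= 5)%N -> pairing (basis_form i) (basis_vec F j) = (i == j)%:R.
Proof.
move=> i5; rewrite pairingE (bigD1_seq i) ?iota_uniq ?mem_indices //=.
rewrite fcoord_basis // eqxx mul1r ecoord_basis // big_seq_cond big1 ?addr0 // => k.
rewrite mem_indices => /andP[k5 /negPf ki].
by rewrite fcoord_basis // ki mul0r.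
Qed.

Lemma mulv_basis v i j :
  (0 < i <= 5)%N -> (0 < j <= 5)%N ->
  mulv (alg F v) (basis_vec F i) (basis_vec F j) =
  \sum_(r <- table v | r.1 \in [:: (i, j); (j, i)])
     \sum_(q <- r.2) q.2%:~R *: basis_vec F q.1.
Proof.
case: i j => // i [// | j] i5 j5.
have basisE k : (0 < k.+1 <= 5)%N -> basis_vec F k.+1 = delta_mx (inord k) 0.
  move=> k5; apply/colP => l.
  by rewrite !mxE andbT -val_eqE /= inordK // eqSS.
apply/colP => k; rewrite !basisE // mulv_delta ffunE productsE big_map summxE.
by apply: eq_big => [[[a b] r]|r _] //=; rewrite !inordK.
Qed.

Lemma det_factor m r (M : 'M[F]_m) (a : 'I_m -> 'I_r -> F) (b : 'I_r -> 'I_m -> F) :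
  (r < m)%N -> (forall i j, M i j = \sum_k a i k * b k j) -> \det M = 0.
Proof.
move=> r_lt_m ME.
rewrite -(det_mulmx_lt (\matrix_(i, k) a i k) (\matrix_(k, j) b k j) r_lt_m).
congr (\det _); apply/matrixP => i j; rewrite ME !mxE.
by apply: eq_bigr => k _; rewrite !mxE.
Qed.

(** When only basis vectors indexed by [S] occur as factors, x y depends only on the [S]-coordinates
    of y. So the matrix factors through a space of dimension [size S], even though each row has its
    own form and left factor. *)
Lemma det_factors_eq0 v (S : seq nat) m (f : 'I_m -> 'rV[F]_5) (x y : 'I_m -> 'cV[F]_5) :
  all (fun r => (r.1.1 \in S) && (r.1.2 \in S)) (table v) -> uniq S ->
  all (mem indices) S -> (size S < m)%N ->
  \det (\matrix_(i, j) pairing (f i) (mulv (alg F v) (x i) (y j))) = 0.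
Proof.
move=> /allP tableS uniqS /allP S5 sizeS.
have S_bounds k : k \in S -> (0 < k <= 5)%N by move=> /S5; rewrite -mem_indices.
pose proj (u : 'cV[F]_5) := \sum_(k <- S) ecoord u k *: basis_vec F k.
have ecoord_proj u k : k \in S -> ecoord (proj u) k = ecoord u k.
  move=> kS; rewrite [LHS]/ecoord summxE (bigD1_seq k) //=.
  rewrite big_seq_cond big1 => [|l /andP[_ lk]].
    by rewrite mxE -/(ecoord _ _) ecoord_basis ?S_bounds // eqxx mulr1 addr0.
  by rewrite mxE -/(ecoord _ _) ecoord_basis ?S_bounds // eq_sym (negPf lk) mulr0.
apply: (@det_factor _ (size S) _
  (fun i k => pairing (f i) (mulv (alg F v) (x i) (basis_vec F (nth 0%N S k))))
  (fun k j => ecoord (y j) (nth 0%N S k))) => // i j.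
rewrite mxE; transitivity (pairing (f i) (mulv (alg F v) (x i) (proj (y j)))).
  rewrite !pairing_mulv; apply: eq_big_seq => r /tableS /andP[r1 r2].
  by rewrite /sym_prod !ecoord_proj.
rewrite /proj mulv_sumr (big_nth 0%N) big_mkord /pairing mulmx_sumr summxE.
by apply: eq_bigr => k _; rewrite -scalemxAr mxE mulrC.
Qed.

(** All products lie in the span of the basis vectors indexed by [S], so the matrix factors through
    that span. *)
Lemma det_products_eq0 v (S : seq nat) m (f : 'I_m -> 'rV[F]_5) (x y : 'I_m -> 'cV[F]_5) :
  all (fun r => all (fun q => q.1 \in S) r.2) (table v) -> (size S < m)%N ->
  \det (\matrix_(i, j) pairing (f i) (mulv (alg F v) (x j) (y j))) = 0.
Proof.
move=> /allP tableS sizeS.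
pose c k (u w : 'cV[F]_5) := \sum_(r <- table v)
  (\sum_(q <- r.2) q.2%:~R * (index q.1 S == k)%:R) * sym_prod u w r.1.1 r.1.2.
apply: (@det_factor _ (size S) _ (fun i k => fcoord (f i) (nth 0%N S k))
  (fun k j => c k (x j) (y j))) => // i j.
rewrite mxE pairing_mulv.
under [RHS]eq_bigr do rewrite mulr_sumr.
rewrite exchange_big; apply: eq_big_seq => r /tableS /allP rS /=.
under [RHS]eq_bigr do rewrite mulrA mulr_sumr.
rewrite -mulr_suml exchange_big; congr (_ * _).
apply: eq_big_seq => q /rS qS /=.
have iS : (index q.1 S < size S)%N by rewrite index_mem.
rewrite (bigD1 (Ordinal iS)) //= eqxx nth_index // mulr1 mulrC big1 ?addr0 // => k.
by rewrite -val_eqE eq_sym /= => /negPf ->; rewrite !mulr0.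
Qed.

End AlgebraForms.

(** * Obstructions *)

Section Invariants.
Variables (F : fieldType) (n : nat).
Implicit Types (mu : mult F n) (x : vectors F n) (f : forms F n).

Definition form2 mu x f (h i j : nat) : F := pairing (f h) (mulv mu (x i) (x j)).

Definition form3 mu x f (h i j k : nat) : F :=
  pairing (f h) (mulv mu (x i) (mulv mu (x j) (x k))).

Definition det3 (a11 a12 a13 a21 a22 a23 a31 a32 a33 : F) : F :=
  a11 * (a22 * a33 - a23 * a32) - a12 * (a21 * a33 - a23 * a31)
  + a13 * (a21 * a32 - a22 * a31).

Definition cubic_discriminant (a b c d : F) : F :=
  b ^+ 2 * c ^+ 2 - 4 * a * c ^+ 3 - 4 * b ^+ 3 * d - 27 * a ^+ 2 * d ^+ 2
  + 18 * a * b * c * d.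

(** Each row of the Gram matrix comes from its own form; by multilinearity in the rows these
    determinants expand the Gram determinant of a pencil of forms. *)
Definition mixed_gram mu x f (h k l : nat) : F :=
  let q := form2 mu x f in
  (det3 (q h 0 0) (q h 0 1) (q h 0 2) (q k 1 0) (q k 1 1) (q k 1 2)
        (q l 2 0) (q l 2 1) (q l 2 2))%N.

(* [gram_coef mu x f m] is the coefficient of s^(3-m) t^m in the Gram determinant
   of x_0, x_1, x_2 for the symmetric bilinear form (s f_0 + t f_1) o mu. *)
Definition gram_coef mu x f (m : nat) : F :=
  let g := mixed_gram mu x f in
  match m with
  | 0 => (g 0 0 0)%N
  | 1 => (g 0 0 1)%N + (g 0 1 0)%N + (g 1 0 0)%N
  | 2 => (g 0 1 1)%N + (g 1 0 1)%N + (g 1 1 0)%N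
  | _ => (g 1 1 1)%N
  end.

(** Plücker coordinates of the pencil spanned by the bilinear forms f_0 o mu and f_1 o mu. *)
Definition pencil_minor mu f (a b c d : 'cV[F]_n) : F :=
  pairing (f 0%N) (mulv mu a b) * pairing (f 1%N) (mulv mu c d)
  - pairing (f 0%N) (mulv mu c d) * pairing (f 1%N) (mulv mu a b).

(** The column [u] imposes one linear condition on the combinations of f_0, f_1, f_2, namely to
    vanish on the cube of x_2; these minors are Plücker coordinates of the resulting pencil. *)
Definition cube_minor mu x f (i j k l : nat) : F :=
  let u (h : nat) := form3 mu x f h 2 2 2 in
  let q := form2 mu x f in
  (det3 (q 0 i j) (q 0 k l) (u 0) (q 1 i j) (q 1 k l) (u 1)
        (q 2 i j) (q 2 k l) (u 2))%N.

(* The cross product of the gradients at x_0 of the quadratic forms f_0 o mu and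
   f_1 o mu on the span of x_0, x_1, x_2 (up to a factor 4). *)
Definition jacobian_vector mu x f : 'cV[F]_n :=
  let T := pencil_minor mu f in
  let x0 := x 0%N in let x1 := x 1%N in let x2 := x 2%N in
  T x0 x1 x0 x2 *: x0 + T x0 x2 x0 x0 *: x1 + T x0 x0 x0 x1 *: x2.

End Invariants.

Section Obstructions.
Variable F : numFieldType.

Definition vectors_of (ks : seq nat) : vectors F 5 :=
  fun i => basis_vec F (nth 0%N ks i).
Definition forms_of (ks : seq nat) : forms F 5 :=
  fun i => basis_form F (nth 0%N ks i).

Definition fc (f : forms F 5) (i k : nat) : F := fcoord (f i) k.
Definition xc (x : vectors F 5) (i k : nat) : F := ecoord (x i) k.

Lemma concomitant_obstruction Phi A B ks ls :
  concomitant Phi -> (forall x f, Phi (alg F A) x f = 0) ->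
  Phi (alg F B) (vectors_of ks) (forms_of ls) != 0 ->
  ~ degenerates_to (alg F A) (alg F B).
Proof.
move=> con PhiA PhiB /(concomitant_degenerates con)/(_ PhiA) PhiB0.
by rewrite PhiB0 eqxx in PhiB.
Qed.

Lemma neq0_of_int (z : int) (a : F) : a = z%:~R -> z != 0 -> a != 0.
Proof. by move=> ->; rewrite intr_eq0. Qed.

Ltac expand_products :=
  rewrite ?pairing_mulv_foldr /sym_prod /= ?ecoord_mulv_foldr // /sym_prod /=
    ?ecoord_mulv_foldr // /sym_prod /=.

(** Reads off a structure constant by simplification, which keeps the Gram determinants of A07 and
    A15 computable. *)
Lemma form2_basis v ks ls h i j :
  let: (l, a, b) := (nth 0 ls h, nth 0 ks i, nth 0 ks j)%N in
  (0 < l <= 5)%N -> (0 < a <= 5)%N -> (0 < b <= 5)%N ->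
  form2 (alg F v) (vectors_of ks) (forms_of ls) h i j =
  foldr (fun r s => if r.1 \in [:: (a, b); (b, a)] then
      foldr (fun q c => if l == q.1 then q.2%:~R + c else c) 0 r.2 + s
    else s) 0 (table v).
Proof.
move=> l5 a5 b5; rewrite /form2 mulv_basis // -big_filter.
elim: (table v) => [|r s IHs] /=; first by rewrite big_nil pairing0.
case: ifP => _ //; rewrite big_cons pairingD IHs; congr (_ + _).
elim: r.2 => [|q c IHc] /=; first by rewrite big_nil pairing0.
rewrite big_cons pairingD IHc {1}/pairing -scalemxAr mxE -/(pairing _ _) pairing_basis //.
by case: eqP => _; rewrite ?mulr1 // mulr0 add0r.
Qed.

Ltac multiply_basis :=
  do 2 rewrite ?mulv_basis //= ?(big_cons, big_nil) /=
    ?(scale1r, scaleN1r, addr0, mulv0, mul0v).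

Ltac expand_basis :=
  rewrite /vectors_of /forms_of /=; multiply_basis;
  rewrite ?pairingD ?pairing_basis ?pairing0 //=.

(** The annihilator has codimension at most [size S] in A, and at least m in B, where the test
    matrix is the identity. The first m entries of [ks] index its rows, the next m its columns. *)
Lemma annihilator_obstruction m A B (S ks ls : seq nat) :
  all (fun r => (r.1.1 \in S) && (r.1.2 \in S)) (table A) -> uniq S ->
  all (mem indices) S -> (size S < m)%N ->
  (forall i j : 'I_m,
     pairing (forms_of ls i)
       (mulv (alg F B) (vectors_of ks i) (vectors_of ks (m + j))) = (i == j)%:R) ->
  ~ degenerates_to (alg F A) (alg F B).
Proof.
move=> AS uniqS S5 Sm MB.
pose Phi mu (x : vectors F 5) (f : forms F 5) :=
  \det (\matrix_(i < m, j < m) pairing (f i) (mulv mu (x i) (x (m + j)%N))).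
apply: (@concomitant_obstruction Phi _ _ ks ls) => [|x f|].
- by rewrite /Phi; concomitant.
- exact: (det_factors_eq0 (fun i => f i) (fun i => x i) _ AS).
rewrite /Phi; set M := \matrix_(i, j) _.
suff -> : M = 1%:M by rewrite det1 oner_neq0.
by apply/matrixP => i j; rewrite !mxE.
Qed.

(** Compares dimensions of the span of all products: at most [size S] in A, at least m in B. Column
    j is tested on the product of the vectors at places j and m + j of [ks]. *)
Lemma square_obstruction m A B (S ks ls : seq nat) :
  all (fun r => all (fun q => q.1 \in S) r.2) (table A) -> (size S < m)%N ->
  (forall i j : 'I_m,
     pairing (forms_of ls i)
       (mulv (alg F B) (vectors_of ks j) (vectors_of ks (m + j))) = (i == j)%:R) ->
  ~ degenerates_to (alg F A) (alg F B).
Proof.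
move=> AS Sm MB.
pose Phi mu (x : vectors F 5) (f : forms F 5) :=
  \det (\matrix_(i < m, j < m) pairing (f i) (mulv mu (x j) (x (m + j)%N))).
apply: (@concomitant_obstruction Phi _ _ ks ls) => [|x f|].
- by rewrite /Phi; concomitant.
- exact: (det_products_eq0 (fun i => f i) (fun i => x i) _ AS).
rewrite /Phi; set M := \matrix_(i, j) _.
suff -> : M = 1%:M by rewrite det1 oner_neq0.
by apply/matrixP => i j; rewrite !mxE.
Qed.

Lemma not_degenerates_A05_A21 : ~ degenerates_to (alg F A05) (alg F A21).
Proof.
apply: (@annihilator_obstruction 4 _ _ [:: 1; 2; 3]
  [:: 1; 2; 3; 4; 4; 3; 2; 1] [:: 5; 5; 5; 5])%N => //.
by move=> [[|[|[|[|i]]]] i4] [[|[|[|[|j]]]] j4] //; expand_basis.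
Qed.

Lemma not_degenerates_A06_A21 : ~ degenerates_to (alg F A06) (alg F A21).
Proof.
apply: (@annihilator_obstruction 4 _ _ [:: 1; 2; 4]
  [:: 1; 2; 3; 4; 4; 3; 2; 1] [:: 5; 5; 5; 5])%N => //.
by move=> [[|[|[|[|i]]]] i4] [[|[|[|[|j]]]] j4] //; expand_basis.
Qed.

Lemma not_degenerates_A07_A21 : ~ degenerates_to (alg F A07) (alg F A21).
Proof.
apply: (@annihilator_obstruction 4 _ _ [:: 1; 2; 3]
  [:: 1; 2; 3; 4; 4; 3; 2; 1] [:: 5; 5; 5; 5])%N => //.
by move=> [[|[|[|[|i]]]] i4] [[|[|[|[|j]]]] j4] //; expand_basis.
Qed.

Lemma not_degenerates_A16_A12 : ~ degenerates_to (alg F A16) (alg F A12).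
Proof.
apply: (@annihilator_obstruction 3 _ _ [:: 1; 2]
  [:: 2; 1; 1; 1; 2; 3] [:: 4; 4; 5])%N => //.
by move=> [[|[|[|i]]] i3] [[|[|[|j]]] j3] //; expand_basis.
Qed.

Lemma not_degenerates_A16_A22 : ~ degenerates_to (alg F A16) (alg F A22).
Proof.
apply: (@annihilator_obstruction 3 _ _ [:: 1; 2]
  [:: 1; 2; 3; 1; 3; 2] [:: 4; 4; 4])%N => //.
by move=> [[|[|[|i]]] i3] [[|[|[|j]]] j3] //; expand_basis.
Qed.

Lemma not_degenerates_A24_A23 : ~ degenerates_to (alg F A24) (alg F A23).
Proof.
apply: (@annihilator_obstruction 2 _ _ [:: 1]
  [:: 1; 2; 2; 1] [:: 3; 3])%N => //.
by move=> [[|[|i]] i2] [[|[|j]] j2] //; expand_basis.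
Qed.

Lemma not_degenerates_C5_A24 : ~ degenerates_to (alg F C5) (alg F A24).
Proof.
apply: (@annihilator_obstruction 1 _ _ [::]
  [:: 1; 1] [:: 2])%N => //.
by move=> [[|i] i1] [[|j] j1] //; expand_basis.
Qed.

Lemma not_degenerates_A07_A16 : ~ degenerates_to (alg F A07) (alg F A16).
Proof.
apply: (@square_obstruction 3 _ _ [:: 4; 5]
  [:: 1; 2; 1; 1; 2; 2] [:: 3; 5; 4])%N => //.
by move=> [[|[|[|i]]] i3] [[|[|[|j]]] j3] //; expand_basis.
Qed.

Lemma not_degenerates_A13_A16 : ~ degenerates_to (alg F A13) (alg F A16).
Proof.
apply: (@square_obstruction 3 _ _ [:: 4; 5]
  [:: 1; 2; 1; 1; 2; 2] [:: 3; 5; 4])%N => //.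
by move=> [[|[|[|i]]] i3] [[|[|[|j]]] j3] //; expand_basis.
Qed.

Lemma not_degenerates_A21_A20 : ~ degenerates_to (alg F A21) (alg F A20).
Proof.
apply: (@square_obstruction 2 _ _ [:: 5]
  [:: 1; 1; 1; 2] [:: 3; 4])%N => //.
by move=> [[|[|i]] i2] [[|[|j]] j2] //; expand_basis.
Qed.

(** Both annihilators have codimension 3, so the rank of a single form f o mu is compared: in A10 it
    is a multiple of e_1^* and has rank at most 2, whereas e_4^* gives rank 3 in A22. *)
Lemma not_degenerates_A10_A22 : ~ degenerates_to (alg F A10) (alg F A22).
Proof.
pose Phi mu (x : vectors F 5) (f : forms F 5) :=
  \det (\matrix_(i < 3, j < 3) form2 mu x f 0 i (3 + j)).
apply: (@concomitant_obstruction Phi _ _ [:: 1; 2; 3; 1; 3; 2] [:: 4])%N.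
- by rewrite /Phi /form2; concomitant.
- move=> x f.
  apply: (@det_factor _ _ 2 _
    (fun i k => if val k == 0%N then xc x i 1
       else fc f 0 5 * xc x i 2 + fc f 0 4 * xc x i 3)
    (fun k j => if val k == 0%N
       then fc f 0 3 * xc x (3 + j) 1
            + fc f 0 5 * xc x (3 + j) 2
            + fc f 0 4 * xc x (3 + j) 3
       else xc x (3 + j) 1)) => // i j.
  rewrite mxE !big_ord_recl big_ord0 /form2; expand_products.
  by rewrite /fc /xc /=; ring.
rewrite /Phi; set M := \matrix_(i, j) _.
suff -> : M = 1%:M by rewrite det1 oner_neq0.
apply/matrixP => -[[|[|[|i]]] i3] [[|[|[|j]]] j3] //; rewrite !mxE /form2;
  by expand_basis.
Qed.

Lemma not_degenerates_A07_A18 : ~ degenerates_to (alg F A07) (alg F A18).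
Proof.
pose Phi mu (x : vectors F 5) (f : forms F 5) := form3 mu x f 0 0 0 0.
apply: (@concomitant_obstruction Phi _ _ [:: 1] [:: 3])%N.
- by rewrite /Phi /form3; concomitant.
- by move=> x f; rewrite /Phi /form3; expand_products; ring.
by rewrite /Phi /form3; expand_basis; rewrite oner_neq0.
Qed.

Lemma not_degenerates_A16_A18 : ~ degenerates_to (alg F A16) (alg F A18).
Proof.
pose Phi mu (x : vectors F 5) (f : forms F 5) := form3 mu x f 0 0 0 0.
apply: (@concomitant_obstruction Phi _ _ [:: 1] [:: 3])%N.
- by rewrite /Phi /form3; concomitant.
- by move=> x f; rewrite /Phi /form3; expand_products; ring.
by rewrite /Phi /form3; expand_basis; rewrite oner_neq0.
Qed.

(** Squares in A03 lie in the span of e_3, e_4, e_5, whose mutual products vanish; in A05 the square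
    of e_1^2 is e_4. *)
Lemma not_degenerates_A03_A05 : ~ degenerates_to (alg F A03) (alg F A05).
Proof.
pose Phi mu (x : vectors F 5) (f : forms F 5) :=
  pairing (f 0) (mulv mu (mulv mu (x 0) (x 0)) (mulv mu (x 0) (x 0))).
apply: (@concomitant_obstruction Phi _ _ [:: 1] [:: 4])%N.
- by rewrite /Phi; concomitant.
- by move=> x f; rewrite /Phi; expand_products; ring.
by rewrite /Phi; expand_basis; rewrite oner_neq0.
Qed.

(** * Obstructions from discriminants, Hessians and resultants *)

Lemma not_degenerates_A02_A03 : ~ degenerates_to (alg F A02) (alg F A03).
Proof.
(* In a commutative associative algebra this is the discriminant of the binary cubic f_0(z^3) at z =
   s x_0 + t x_1; the factors 3 are binomial coefficients. *)
pose Phi mu (x : vectors F 5) (f : forms F 5) :=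
  cubic_discriminant (form3 mu x f 0 0 0 0) (3 * form3 mu x f 0 0 0 1)
  (3 * form3 mu x f 0 0 1 1) (form3 mu x f 0 1 1 1).
apply: (@concomitant_obstruction Phi _ _ [:: 1; 2] [:: 5])%N.
- by rewrite /Phi /cubic_discriminant /form3; concomitant.
- move=> x f.
  (* On a plane, the cubic form f(x^3) has the square of e_1^* as a factor. *)
  have formE i j k : form3 (alg F A02) x f 0 i j k =
      fc f 0 4 * xc x i 1 * xc x j 1 * xc x k 1
      + fc f 0 5 * (xc x i 1 * xc x j 1 * xc x k 3 + xc x i 1 * xc x j 3 * xc x k 1
                    + xc x i 3 * xc x j 1 * xc x k 1).
    by rewrite /form3; expand_products; rewrite /fc /xc; ring.
  by rewrite /Phi /cubic_discriminant !formE; ring.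
(* In A03 the cubic is s^3 + t^3, of discriminant -27. *)
rewrite /Phi /cubic_discriminant /form3; expand_basis.
by apply: (@neq0_of_int (-27)) => //; ring.
Qed.

Lemma not_degenerates_A03_A07 : ~ degenerates_to (alg F A03) (alg F A07).
Proof.
pose Phi mu (x : vectors F 5) (f : forms F 5) :=
  cubic_discriminant (gram_coef mu x f 0) (gram_coef mu x f 1)
    (gram_coef mu x f 2) (gram_coef mu x f 3).
apply: (@concomitant_obstruction Phi _ _ [:: 1; 2; 3] [:: 4; 5])%N.
- by rewrite /Phi /cubic_discriminant /gram_coef /mixed_gram /det3 /form2; concomitant.
- move=> x f.
  have formE k i j : form2 (alg F A03) x f k i j =
      fc f k 3 * xc x i 1 * xc x j 1 + fc f k 4 * xc x i 2 * xc x j 2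
      + fc f k 5 * (xc x i 1 * xc x j 3 + xc x i 3 * xc x j 1
                    + xc x i 2 * xc x j 4 + xc x i 4 * xc x j 2).
    by rewrite /form2; expand_products; rewrite /fc /xc; ring.
  (* The Gram determinant of f o mu is f_5^2 times a form linear in f, because
     e_3 and e_4 span a common isotropic subspace of the forms f o mu. *)
  pose m a b c := det3 (xc x 0 a) (xc x 0 b) (xc x 0 c) (xc x 1 a) (xc x 1 b) (xc x 1 c)
                       (xc x 2 a) (xc x 2 b) (xc x 2 c).
  pose L k := - fc f k 3 * (m 1 2 4)%N ^+ 2 - fc f k 4 * (m 1 2 3)%N ^+ 2
    + 2 * fc f k 5 * ((m 2 3 4)%N * (m 1 2 4)%N + (m 1 3 4)%N * (m 1 2 3)%N).
  have c0 : gram_coef (alg F A03) x f 0 = fc f 0 5 ^+ 2 * L 0%N.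
    by rewrite /gram_coef /mixed_gram !formE /L /m /det3; ring.
  have c1 : gram_coef (alg F A03) x f 1 =
      2 * fc f 0 5 * fc f 1 5 * L 0%N + fc f 0 5 ^+ 2 * L 1%N.
    by rewrite /gram_coef /mixed_gram !formE /L /m /det3; ring.
  have c2 : gram_coef (alg F A03) x f 2 =
      2 * fc f 0 5 * fc f 1 5 * L 1%N + fc f 1 5 ^+ 2 * L 0%N.
    by rewrite /gram_coef /mixed_gram !formE /L /m /det3; ring.
  have c3 : gram_coef (alg F A03) x f 3 = fc f 1 5 ^+ 2 * L 1%N.
    by rewrite /gram_coef /mixed_gram !formE /L /m /det3; ring.
  by rewrite /Phi c0 c1 c2 c3 /cubic_discriminant; ring.
(* In A07 the Gram determinant is 2 s t (s + t), with three distinct roots and discriminant 16. *)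
rewrite /Phi /gram_coef /mixed_gram !form2_basis //=.
rewrite /cubic_discriminant /det3.
by apply: (@neq0_of_int 16) => //; ring.
Qed.

Lemma not_degenerates_A05_A15 : ~ degenerates_to (alg F A05) (alg F A15).
Proof.
(* Up to a scalar, the leading coefficient of the Hessian of the binary cubic; the Hessian of a cube
   of a linear form vanishes. *)
pose Phi mu (x : vectors F 5) (f : forms F 5) :=
  gram_coef mu x f 1 ^+ 2 - 3 * gram_coef mu x f 0 * gram_coef mu x f 2.
apply: (@concomitant_obstruction Phi _ _ [:: 1; 2; 4] [:: 3; 5])%N.
- by rewrite /Phi /gram_coef /mixed_gram /det3 /form2; concomitant.
- move=> x f.
  have formE k i j : form2 (alg F A05) x f k i j =
      fc f k 2 * xc x i 1 * xc x j 1
      + fc f k 3 * (xc x i 1 * xc x j 2 + xc x i 2 * xc x j 1)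
      + fc f k 4 * (xc x i 2 * xc x j 2 + xc x i 1 * xc x j 3 + xc x i 3 * xc x j 1).
    by rewrite /form2; expand_products; rewrite /fc /xc; ring.
  pose m := det3 (xc x 0 1) (xc x 0 2) (xc x 0 3)
                 (xc x 1 1) (xc x 1 2) (xc x 1 3)
                 (xc x 2 1) (xc x 2 2) (xc x 2 3).
  (* The Gram determinant of f o mu is the cube of f_4, up to a factor
     independent of f. *)
  have c0 : gram_coef (alg F A05) x f 0 = - m ^+ 2 * fc f 0 4 ^+ 3.
    by rewrite /gram_coef /mixed_gram !formE /m /det3; ring.
  have c1 : gram_coef (alg F A05) x f 1 = - 3 * m ^+ 2 * fc f 0 4 ^+ 2 * fc f 1 4.
    by rewrite /gram_coef /mixed_gram !formE /m /det3; ring.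
  have c2 : gram_coef (alg F A05) x f 2 = - 3 * m ^+ 2 * fc f 0 4 * fc f 1 4 ^+ 2.
    by rewrite /gram_coef /mixed_gram !formE /m /det3; ring.
  by rewrite /Phi c0 c1 c2; ring.
(* In A15 the Gram determinant is - s^2 t, which is not a cube. *)
rewrite /Phi /gram_coef /mixed_gram !form2_basis //= /det3.
by apply: (@neq0_of_int 1) => //; ring.
Qed.

(* In A10 all the forms f o mu are divisible by e_1^*, so the resultant of two of
   their restrictions to a plane vanishes. *)
Lemma not_degenerates_A10_A19 : ~ degenerates_to (alg F A10) (alg F A19).
Proof.
pose Phi mu (x : vectors F 5) (f : forms F 5) :=
  (* The resultant of two binary quadratic forms in terms of 2 x 2 minors; the 4 appears because the
     middle coefficients are 2 f(x_0 x_1). *)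
  let T i j k l := pencil_minor mu f (x i) (x j) (x k) (x l) in
  (T 1 1 0 0)%N ^+ 2 - 4 * (T 0 1 1 1)%N * (T 0 0 0 1)%N.
apply: (@concomitant_obstruction Phi _ _ [:: 1; 2] [:: 3; 4])%N.
- by rewrite /Phi /pencil_minor; concomitant.
- by move=> x f; rewrite /Phi /pencil_minor; expand_products; ring.
rewrite /Phi /pencil_minor; expand_basis.
by apply: (@neq0_of_int 1) => //; ring.
Qed.

(* The same resultant, for the forms f o mu with f vanishing on the cubes: in A04
   these are again divisible by e_1^*. *)
Lemma not_degenerates_A04_A06 : ~ degenerates_to (alg F A04) (alg F A06).
Proof.
pose Phi mu (x : vectors F 5) (f : forms F 5) :=
  let T := cube_minor mu x f in
  (T 1 1 0 0)%N ^+ 2 - 4 * (T 0 1 1 1)%N * (T 0 0 0 1)%N.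
apply: (@concomitant_obstruction Phi _ _ [:: 1; 4; 1] [:: 2; 5; 3])%N.
- by rewrite /Phi /cube_minor /det3 /form2 /form3; concomitant.
- move=> x f.
  pose m := det3 (fc f 0 3) (fc f 0 4) (fc f 0 5)
                 (fc f 1 3) (fc f 1 4) (fc f 1 5)
                 (fc f 2 3) (fc f 2 4) (fc f 2 5).
  (* In A04 the cube of x is 3 x_1^2 x_2 e_5. The forms killing e_5 are spanned by e_3^* and e_4^*
     on products, giving x_1^2 and 2 x_1 x_2; the last factor is their minor, up to scalars. *)
  have minorE i j k l : cube_minor (alg F A04) x f i j k l =
      3 * m * xc x 2 1 ^+ 2 * xc x 2 2 *
      (xc x i 1 * xc x j 1 * (xc x k 1 * xc x l 2 + xc x k 2 * xc x l 1)
       - xc x k 1 * xc x l 1 * (xc x i 1 * xc x j 2 + xc x i 2 * xc x j 1)).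
    rewrite /cube_minor /form2 /form3; expand_products.
    by rewrite /m /det3 /fc /xc; ring.
  by rewrite /Phi /= !minorE; ring.
rewrite /Phi /cube_minor /det3 /form2 /form3; expand_basis.
by apply: (@neq0_of_int 1) => //; ring.
Qed.

(* In A13 each pencil of forms f o mu contains the square of e_3^*, so the cross
   product of the gradients is divisible by e_3^* and lies in the kernel of e_3^*:
   composed with itself, this quadratic map is zero. *)
Lemma not_degenerates_A13_A12 : ~ degenerates_to (alg F A13) (alg F A12).
Proof.
pose Phi mu (x : vectors F 5) (f : forms F 5) :=
  let w := jacobian_vector mu x f in
  pencil_minor mu f w (x 1%N) w (x 2%N).
apply: (@concomitant_obstruction Phi _ _ [:: 1; 2; 3] [:: 4; 5])%N.
- by rewrite /Phi /jacobian_vector /pencil_minor; concomitant.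
- move=> x f; rewrite /Phi /=.
  have minorE (a b c d : 'cV[F]_5) : pencil_minor (alg F A13) f a b c d =
      (fcoord (f 0%N) 4 * fcoord (f 1%N) 5 - fcoord (f 0%N) 5 * fcoord (f 1%N) 4) *
      (ecoord a 3 * ecoord b 3 * (ecoord c 1 * ecoord d 2 + ecoord c 2 * ecoord d 1
         + ecoord c 3 * ecoord d 4 + ecoord c 4 * ecoord d 3)
       - ecoord c 3 * ecoord d 3 * (ecoord a 1 * ecoord b 2 + ecoord a 2 * ecoord b 1
         + ecoord a 3 * ecoord b 4 + ecoord a 4 * ecoord b 3)).
    by rewrite /pencil_minor; expand_products; ring.
  have w3 : ecoord (jacobian_vector (alg F A13) x f) 3 = 0.
    by rewrite /jacobian_vector !ecoordD !ecoordZ !minorE; ring.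
  by rewrite minorE w3; ring.
(* In A12 the cross product at e_1 is e_1 itself, so iterating it does not give zero. *)
rewrite /Phi /jacobian_vector /pencil_minor; expand_basis.
rewrite !(mul0r, mulr0, mul1r, subr0, scale0r, scale1r, addr0); expand_basis.
by apply: (@neq0_of_int 1) => //; ring.
Qed.

Definition obstructions : seq (vertex * vertex) :=
  [:: (A02, A03); (A03, A05); (A03, A07); (A04, A06); (A05, A15); (A05, A21);
      (A06, A21); (A07, A16); (A07, A18); (A07, A21); (A10, A19); (A10, A22);
      (A13, A12); (A13, A16); (A16, A12); (A16, A18); (A16, A22); (A21, A20);
      (A24, A23); (C5, A24)].

Lemma obstructions_not_degenerates A B :
  (A, B) \in obstructions -> ~ degenerates_to (alg F A) (alg F B).
Proof.
case/predU1P => [[-> ->] | ]; first exact: not_degenerates_A02_A03.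
case/predU1P => [[-> ->] | ]; first exact: not_degenerates_A03_A05.
case/predU1P => [[-> ->] | ]; first exact: not_degenerates_A03_A07.
case/predU1P => [[-> ->] | ]; first exact: not_degenerates_A04_A06.
case/predU1P => [[-> ->] | ]; first exact: not_degenerates_A05_A15.
case/predU1P => [[-> ->] | ]; first exact: not_degenerates_A05_A21.
case/predU1P => [[-> ->] | ]; first exact: not_degenerates_A06_A21.
case/predU1P => [[-> ->] | ]; first exact: not_degenerates_A07_A16.
case/predU1P => [[-> ->] | ]; first exact: not_degenerates_A07_A18.
case/predU1P => [[-> ->] | ]; first exact: not_degenerates_A07_A21.
case/predU1P => [[-> ->] | ]; first exact: not_degenerates_A10_A19.
case/predU1P => [[-> ->] | ]; first exact: not_degenerates_A10_A22.
case/predU1P => [[-> ->] | ]; first exact: not_degenerates_A13_A12.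
case/predU1P => [[-> ->] | ]; first exact: not_degenerates_A13_A16.
case/predU1P => [[-> ->] | ]; first exact: not_degenerates_A16_A12.
case/predU1P => [[-> ->] | ]; first exact: not_degenerates_A16_A18.
case/predU1P => [[-> ->] | ]; first exact: not_degenerates_A16_A22.
case/predU1P => [[-> ->] | ]; first exact: not_degenerates_A21_A20.
case/predU1P => [[-> ->] | ]; first exact: not_degenerates_A24_A23.
case/predU1P => [[-> ->] | ]; first exact: not_degenerates_C5_A24.
by [].
Qed.

End Obstructions.

(** * The degeneration graph *)

(** A search of depth m that evaluates, so that the whole table of pairs can be checked by
    computation. *)
Fixpoint reach (m : nat) (A : vertex) : seq vertex :=
  A :: if m is m'.+1 then flatten [seq reach m' B | B <- successors A] else [::].

Lemma reach_connect m A B : B \in reach m A -> connect edge A B.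
Proof.
elim: m A => [|m IHm] A /=; rewrite in_cons => /predU1P[-> | //]; rewrite ?connect0 //.
move=> /flatten_mapP[C AC /IHm]; apply: connect_trans.
exact: connect1.
Qed.

(* 12 bounds the length of the paths in the graph. *)
Lemma obstructions_cover :
  all (fun A => all (fun B => (B \in reach 12 A) ||
        has (fun c => (A \in reach 12 c.1) && (c.2 \in reach 12 B)) obstructions)
      vertices) vertices.
Proof. by vm_compute. Qed.

Lemma degenerates_connect (F : numClosedFieldType) A B :
  degenerates_to (alg F A) (alg F B) -> connect edge A B.
Proof.
move=> degAB; have allv C : C \in vertices by case: C.
have /orP[/reach_connect // | /hasP[[C D] CD /andP[CA BD]]] :=
  allP (allP obstructions_cover A (allv A)) B (allv B).
(* Paths from C to A and from B to D would extend the degeneration to the excluded pair (C, D). *)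
case: (obstructions_not_degenerates (F := F) CD).
have degCA := @connect_degenerates F _ _ (reach_connect CA).
have degBD := @connect_degenerates F _ _ (reach_connect BD).
exact: degenerates_trans degCA (degenerates_trans degAB degBD).
Qed.

Local Open Scope complex_scope.

Theorem theorem2 (R : realType) (A B : vertex) :
  degenerates_to (alg R[i] A) (alg R[i] B) <-> connect edge A B.
Proof. by split; [exact: degenerates_connect | exact: connect_degenerates]. Qed.
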